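(* Let $d\in\mathbb{N}$, let $K$ be a compact abelian group and let $u:\mathbb{N}^d\to K$ be such that for any $h\in\mathbb{N}^d$ the map $n\mapsto u(n+h)-u(n)$ is uniformly distributed in $K$. Let $n:\mathbb{N}^d\to\mathbb{N}^d$ be an increasing Besicovitch sequence. Then the sequence $k\mapsto u\big(n(k)\big)$ is uniformly distributed in $K$. Moreover, if for every $h\in\mathbb{N}^d$ the map $m\mapsto u(m+h)-u(m)$ is well distributed in $K$ and $n$ is a uniform Besicovitch sequence, then $k\mapsto u\big(n(k)\big)$ is well distributed in $K$.
   Context: $\mathbb{N}=\{1,2,\dots\}$, $\mathbb{T}=\mathbb{R}/\mathbb{Z}$, $[1,N]=\{1,\dots,N\}$. Let $\mu$ be the normalized Haar measure on $K$. A map $v:\mathbb{N}^d\to K$ is uniformly distributed if $\lim_{N\to\infty}\frac1{N^d}|\{t\in[1,N]^d:v(t)\in U\}|=\mu(U)$ for every open $U\subset K$ whose boundary has $\mu$-measure $0$; it is well distributed if for every such $U$, $\lim_{N\to\infty}\frac1{N^d}|\{t\in m+[1,N]^d:v(t)\in U\}|=\mu(U)$ uniformly in $m\in\mathbb{N}^d$. For $A\subset\mathbb{N}^d$ the upper density is $\bar d(A)=\limsup_{N\to\infty}\frac{|A\cap\{1,\dots,N\}^d|}{N^d}$ and the lower Banach density is $d_*(A)=\liminf_{N\to\infty}\inf_{(M_1,\dots,M_d)\in\mathbb{N}^d}\frac{|A\cap\prod_{i=1}^d\{M_i+1,\dots,M_i+N\}|}{N^d}$. A function $f:\mathbb{N}^d\to\mathbb{C}$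 is Besicovitch almost periodic if for any $\epsilon>0$ there exist $\ell\in\mathbb{N}$, $\alpha_1,\dots,\alpha_\ell\in\mathbb{T}^d$, $c_1,\dots,c_\ell\in\mathbb{C}$ such that $\limsup_{N\to\infty}\frac1{N^d}\sum_{n\in[1,N]^d}\big|f(n)-\sum_{j=1}^\ell c_j e^{2\pi i\langle\alpha_j,n\rangle}\big|<\epsilon$. It is uniform Besicovitch almost periodic if for any $\epsilon>0$ there are such $\ell,\alpha_j,c_j$ with $\limsup_{N\to\infty}\sup_{m\in\mathbb{N}^d}\frac1{N^d}\sum_{n\in m+[1,N]^d}\big|f(n)-\sum_{j=1}^\ell c_je^{2\pi i\langle\alpha_j,n\rangle}\big|<\epsilon$. A sequence $n:\mathbb{N}^d\to\mathbb{N}^d$ is increasing if for all $a,b\in\mathbb{N}^d$ and every coordinate $j\in\{1,\dots,d\}$: $a_j\le b_j$ implies $n(a)_j\le n(b)_j$, and $a_j<b_j$ implies $n(a)_j<n(b)_j$. An increasing sequence $n:\mathbb{N}^d\to\mathbb{N}^d$ is a Besicovitch sequence if the indicator function of $A=\{n(k):k\in\mathbb{N}^d\}$ is Besicovitch almost periodic and $\bar d(A)>0$; it is a uniform Besicovitch sequence if this indicator function is uniform Besicovitch almost periodic and $d_*(A)>0$. *)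

(* Defs.v *)
From HB Require Import structures.
From mathcomp Require Import all_boot all_order all_algebra finmap.
From mathcomp Require Import complex.
From mathcomp Require Import all_classical all_reals all_analysis.
Import Order.TTheory GRing.Theory Num.Theory.
Import numFieldNormedType.Exports.

Set Implicit Arguments.
Unset Strict Implicit.
Unset Printing Implicit Defensive.

Local Open Scope classical_set_scope.
Local Open Scope ring_scope.

(* The set N^d, with N = {1, 2, ...}, is the subset Npos d of vec d. Functions
   on N^d are represented by functions on vec d, of which every definition
   below uses only the values on Npos d. *)
Definition vec (d : nat) := {ffun 'I_d -> nat}.

Definition Npos (d : nat) : set (vec d) :=
  [set a : vec d | forall j, (0 < a j)%N].

(* box m N is m + [1, N]^d; in particular box 0 N is [1, N]^d. *)
Definition box (d : nat) (m : vec d) (N : nat) : set (vec d) :=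
  [set t : vec d | forall j, (m j < t j <= m j + N)%N].

Definition box_freq (R : realType) (d : nat) (A : set (vec d)) (m : vec d)
    (N : nat) : R :=
  #|` fset_set (A `&` box m N)|%:R / N%:R ^+ d.

Definition box_avg (R : realType) (d : nat) (g : vec d -> R) (m : vec d)
    (N : nat) : R :=
  (\sum_(t \in box m N) g t) / N%:R ^+ d.

(* K as a measurable space with its Borel sigma-algebra. Since a measurableType
   is pointed and a topologicalZmodType is not, K is first pointed at 0. *)
Definition pointed_group (K : topologicalZmodType) : Type := K.

HB.instance Definition _ (K : topologicalZmodType) :=
  Choice.copy (pointed_group K) K.
HB.instance Definition _ (K : topologicalZmodType) :=
  isPointed.Build (pointed_group K) (0 : K).

Definition borel (K : topologicalZmodType) :=
  g_sigma_algebraType (@open K : set (set (pointed_group K))).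

(* Haar measure is a Radon measure: the two regularity clauses are automatic
   when K is metrizable, and are needed for uniqueness in general. *)
Definition is_haar (R : realType) (K : topologicalZmodType)
    (mu : probability (borel K) R) : Prop :=
  [/\ forall (a : K) (A : set (borel K)), measurable A ->
        mu [set a + x | x in (A : set K)] = mu A,
      forall A : set (borel K), measurable A ->
        mu A = ereal_inf [set mu V | V in
                           [set V : set K | open V /\ A `<=` V]] &
      forall V : set K, open V ->
        mu V = ereal_sup [set mu C | C in
                           [set C : set K | compact C /\ C `<=` V]]].

Definition boundary (T : topologicalType) (U : set T) : set T :=
  closure U `\` interior U.

Definition uniformly_distributed (R : realType) (K : topologicalZmodType)
    (mu : probability (borel K) R) (d : nat) (v : vec d -> K) : Prop :=
  forall U : set K, open U -> mu (boundary U) = 0%E ->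
    box_freq R (v @^-1` U) 0 N @[N --> \oo] --> fine (mu U).

Definition well_distributed (R : realType) (K : topologicalZmodType)
    (mu : probability (borel K) R) (d : nat) (v : vec d -> K) : Prop :=
  forall U : set K, open U -> mu (boundary U) = 0%E ->
    {uniform (@Npos d),
      (fun (N : nat) (m : vec d) => box_freq R (v @^-1` U) m N) @ \oo
        --> (fun=> fine (mu U))}.

Definition upper_density (R : realType) (d : nat) (A : set (vec d)) : \bar R :=
  limn_esup (fun N => (box_freq R A 0 N)%:E).

Definition lower_banach_density (R : realType) (d : nat) (A : set (vec d)) :
    \bar R :=
  limn_einf (fun N =>
    ereal_inf [set (box_freq R A M N)%:E | M in @Npos d]).

(* trig_poly alpha c n = \sum_j c_j exp(2 pi i <alpha_j, n>); the points
   alpha_j of the torus (R/Z)^d are given by representatives in R^d, on which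
   the value does not depend since n has integer coordinates. *)
Definition trig_poly (R : realType) (d l : nat)
    (alpha : 'I_l -> {ffun 'I_d -> R}) (c : 'I_l -> R[i]) (n : vec d) : R[i] :=
  \sum_(j < l)
    let x := 2 * pi * \sum_(i < d) alpha j i * (n i)%:R in
    c j * (cos x +i* sin x)%C.

(* normc is the R-valued modulus (`|z| for z : R[i] is an element of R[i]). *)
Definition trig_dist (R : realType) (d l : nat) (f : vec d -> R[i])
    (alpha : 'I_l -> {ffun 'I_d -> R}) (c : 'I_l -> R[i]) (n : vec d) : R :=
  Normc.normc (f n - trig_poly alpha c n).

Definition besicovitch_ap (R : realType) (d : nat) (f : vec d -> R[i]) : Prop :=
  forall eps : R, 0 < eps ->
    exists (l : nat) (alpha : 'I_l -> {ffun 'I_d -> R}) (c : 'I_l -> R[i]),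
      (0 < l)%N /\
      (limn_esup (fun N => (box_avg (trig_dist f alpha c) 0 N)%:E) < eps%:E)%E.

Definition uniform_besicovitch_ap (R : realType) (d : nat)
    (f : vec d -> R[i]) : Prop :=
  forall eps : R, 0 < eps ->
    exists (l : nat) (alpha : 'I_l -> {ffun 'I_d -> R}) (c : 'I_l -> R[i]),
      (0 < l)%N /\
      (limn_esup (fun N =>
         ereal_sup [set (box_avg (trig_dist f alpha c) m N)%:E | m in @Npos d])
       < eps%:E)%E.

Definition increasing_vec (d : nat) (n : vec d -> vec d) : Prop :=
  forall a b : vec d, Npos a -> Npos b -> forall j : 'I_d,
    ((a j <= b j)%N -> (n a j <= n b j)%N) /\
    ((a j < b j)%N -> (n a j < n b j)%N).

Definition besicovitch_sequence (R : realType) (d : nat)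
    (n : vec d -> vec d) : Prop :=
  [/\ {homo n : a / Npos a}, increasing_vec n,
      besicovitch_ap (\1_(n @` @Npos d) : vec d -> R[i]) &
      (0 < upper_density R (n @` @Npos d))%E].

Definition uniform_besicovitch_sequence (R : realType) (d : nat)
    (n : vec d -> vec d) : Prop :=
  [/\ {homo n : a / Npos a}, increasing_vec n,
      uniform_besicovitch_ap (\1_(n @` @Npos d) : vec d -> R[i]) &
      (0 < lower_banach_density R (n @` @Npos d))%E].

(* Main.v *)
Require Import Defs.
From HB Require Import structures.
From mathcomp Require Import all_boot all_order all_algebra finmap.
From mathcomp Require Import complex.
From mathcomp Require Import all_classical all_reals all_analysis.
From mathcomp Require Import measurable_realfun.
From mathcomp Require Import zify ring lra.
Import Order.TTheory GRing.Theory Num.Theory.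
Import numFieldNormedType.Exports.

Set Implicit Arguments.
Unset Strict Implicit.
Unset Printing Implicit Defensive.

Local Open Scope classical_set_scope.
Local Open Scope ring_scope.

(** The proof combines continuous test functions on K with van der Corput's
    inequality in the Hilbert space L^2(K).

    By regularity of Haar measure and Urysohn's lemma it is enough to average
    continuous functions f on K, and f may be taken of mean zero
    ([ud_on_of_continuous]).  Write A = n(N^d).  As n is increasing coordinate
    by coordinate, A is a product of subsets of N, and n maps the box
    m + [1, N]^d onto the points of A in some rectangle.  So the claim is that
    the weight 1_A kills f o u on rectangles: the sum of 1_A(x) f(u(x)) over a
    rectangle lying in a box of side L is o(L^d) ([null_weight]).  The positive
    density of A makes L at most a constant times N ([nu_growth]).

    The property [null_weight] is linear and stable under approximation in mean,
    so the almost periodicity of 1_A reduces it to the weights cos(theta) and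
    sin(theta) with theta additive ([null_weight_approx]).  For these, each
    point x is given the function z |-> f(z + u(x)) of L^2(K).  The inner
    product of two such functions depends only on the difference of the two
    values of u ([Rintegral_corr]).  Along the diagonal shifts (t, ..., t), the
    differences u(x + h) - u(x) are equidistributed by hypothesis, so the
    correlations average to 0, and van der Corput's inequality shows that
    z |-> sum of cos(theta(x)) f(z + u(x)) is small in L^2(K) ([wsum_L2_small]).
    These functions of z are equicontinuous and nonempty open sets have positive
    measure, so they are small at z = 0 too ([small_L2_small_at0]).

    Two points deserve care.  The hypothesis speaks of cubes only, while the
    sums run over rectangles: the Cauchy-Schwarz step of van der Corput's
    inequality replaces the rectangle by the cube around it, since the terms are
    then squares ([van_der_corput]).  And the hypothesis speaks only of h with
    positive coordinates, whence the restriction to diagonal shifts: the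
    difference of two of them is 0 or plus or minus such an h.

    Everything is done for boxes based at an arbitrary set B of points: B = {0}
    gives uniform distribution and B = N^d gives well distribution. *)

(** * Sums over rectangles *)

(** Given as an explicit image so that its cardinality can be read off. *)
Definition rect d (p q : vec d) : {fset vec d} :=
  [fset ([ffun j => (p j + (k j).+1)%N] : vec d)
    | k : {dffun forall j : 'I_d, 'I_(q j - p j)} in predT]%fset.

Lemma rectP d (p q x : vec d) :
  reflect (forall j, (p j < x j <= q j)%N) (x \in rect p q).
Proof.
apply: (iffP idP).
  move=> /imfsetP[k _ ->] j; rewrite ffunE; have := ltn_ord (k j);
    move: (nat_of_ord (k j)); lia.
move=> px; apply/imfsetP.
have H j : (x j - (p j).+1 < q j - p j)%N by have := px j; lia.
exists [ffun j => Ordinal (H j)] => //.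
by apply/ffunP => j; rewrite !ffunE /=; have := px j; lia.
Qed.

Lemma card_rect d (p q : vec d) : #|` rect p q| = (\prod_j (q j - p j))%N.
Proof.
rewrite card_imfset /=; last first.
  move=> k l /ffunP kl; apply/ffunP => j; apply: val_inj.
  by have := kl j; rewrite !ffunE /=; lia.
rewrite -cardE card_dep_ffun foldrE big_map big_enum /=.
by apply: eq_bigr => j _; rewrite card_ord.
Qed.

Lemma vecD d (x h : vec d) j : (x + h)%R j = (x j + h j)%N.
Proof. by rewrite ffunE. Qed.

(** [lia] sees distinct atoms in one coordinate written at two convertible
    types; abstracting the j-th coordinates identifies them. *)
Ltac coord_lia j := rewrite ?(vecD, ffunE) /=;
  repeat (match goal with
          | |- context [@fun_of_fin _ _ _ ?x j] => move: (x j) => ?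
          end); lia.

Definition diagv d (L : nat) : vec d := [ffun=> L].

Lemma boxE d (m : vec d) N : box m N = [set` rect m (m + diagv d N)].
Proof.
apply/seteqP; split => x /=.
  by move=> h; apply/rectP => j; rewrite !(vecD, ffunE); exact: h.
by move=> /rectP h j; have := h j; rewrite !(vecD, ffunE).
Qed.

Lemma card_box d (m : vec d) N : #|` rect m (m + diagv d N)| = (N ^ d)%N.
Proof.
rewrite card_rect -[in RHS](card_ord d) -prod_nat_const.
by apply: eq_bigr => j _; rewrite vecD ffunE addnC addnK.
Qed.

Lemma rect_sub_box d (b p q : vec d) (L : nat) :
    (forall i, b i <= p i)%N -> (forall i, q i <= b i + L)%N ->
  (rect p q `<=` rect b (b + diagv d L)%R)%fset.
Proof.
move=> bp qb; apply/fsubsetP => x /rectP xr; apply/rectP => j.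
by have := xr j; have := bp j; have := qb j; coord_lia j.
Qed.

Section sums.
Context {R : realType} {d : nat}.
Implicit Types (p q b m h : vec d) (g : vec d -> R) (A : set (vec d)).

Lemma box_avgE g m N :
  box_avg g m N = (\sum_(x <- rect m (m + diagv d N)) g x) / N%:R ^+ d.
Proof.
congr (_ / _); rewrite boxE fsbig_finite//=.
by rewrite set_fsetK.
Qed.

Lemma box_freqE A m N :
  box_freq R A m N = box_avg (\1_A : vec d -> R) m N.
Proof.
rewrite box_avgE /box_freq; congr (_ / _).
set X := rect m _.
have -> : fset_set (A `&` box m N) = [fset x in X | x \in A]%fset.
  apply/fsetP => x; rewrite in_fset_set; last first.
    by rewrite boxE; apply: finite_setIr; exact: finite_fset.
  rewrite !inE boxE andbC in_setI; congr (_ && _).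
  by apply/idP/idP; rewrite inE.
rewrite -sum1_size natr_sum big_fset big_mkcond /=.
by apply: eq_bigr => x _; rewrite indicE; case: (_ \in _).
Qed.

Lemma sum_fset_le (T : choiceType) (X Y : {fset T}) (g : T -> R) :
    (X `<=` Y)%fset -> (forall x, 0 <= g x) ->
  \sum_(x <- X) g x <= \sum_(x <- Y) g x.
Proof.
move=> XY g0; rewrite (big_fsetID _ (mem X) Y) /=.
have -> : [fset x in Y | mem X x]%fset = X.
  apply/fsetP => x; rewrite !inE /= andbC; apply/andP/idP => [[]//|xX].
  by split => //; exact: (fsubsetP XY).
by rewrite lerDl sumr_ge0.
Qed.

Lemma card_fset_le (T : choiceType) (X Y : {fset T}) : {subset X <= Y} ->
    (#|` X| <= #|` Y|)%N.
Proof. by move=> /fsubsetP/fsubset_leq_card. Qed.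

Lemma sum_fset_const (T : choiceType) (X : {fset T}) (c : R) :
  \sum_(x <- X) c = #|` X|%:R * c.
Proof. by rewrite big_const_seq count_predT iter_addr_0 mulr_natl. Qed.

Lemma normr_sum_fset (T : choiceType) (X : {fset T}) (g : T -> R) (M : R) :
  (forall x, `|g x| <= M) -> `|\sum_(x <- X) g x| <= #|` X|%:R * M.
Proof.
move=> gM; apply: le_trans (ler_norm_sum _ _ _) _.
by rewrite -sum_fset_const; apply: ler_sum.
Qed.

Lemma sum_rect_shift g p q h :
  \sum_(x <- rect p q) g (x + h) = \sum_(x <- rect (p + h) (q + h)) g x.
Proof.
have -> : rect (p + h) (q + h) = [fset (x + h)%R | x in rect p q]%fset.
  apply/fsetP => x; apply/rectP/imfsetP => /=.
    move=> xr; exists [ffun j => (x j - h j)%N].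
      by apply/rectP => j; have := xr j; coord_lia j.
    by apply/ffunP => j; have := xr j; coord_lia j.
  move=> [y /rectP yr ->] j; have := yr j; coord_lia j.
rewrite [RHS]big_imfset //= => x y _ _ /ffunP xy; apply/ffunP => j.
by have := xy j; coord_lia j.
Qed.

(** A slab of thickness t in one coordinate loses a factor L in cardinality;
    this is why all boundary terms below are negligible. *)
Lemma card_rect_slab p q L (j : 'I_d) (t : nat) : (forall i, q i - p i <= L)%N
    ->
  (#|` [fset x in rect p q | x j <= p j + t]%fset| <= t * L ^ d.-1)%N.
Proof.
move=> qpL.
pose q' : vec d := [ffun i => if i == j then minn (q j) (p j + t)%N else q i].
apply: (@leq_trans #|` rect p q'|).
  apply: card_fset_le => x; rewrite !inE /= => /andP[/rectP xr xj].
  apply/rectP => i; rewrite ffunE; case: eqP => [->|_]; last exact: xr.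
  have := xr j; lia.
rewrite card_rect (bigD1 j) //= leq_mul//.
  rewrite ffunE eqxx; lia.
have -> : (d.-1 = #|[pred i : 'I_d | i != j]|)%N.
  by rewrite -[in LHS](card_ord d) (cardD1 j) /= ; apply: eq_card => i;
    rewrite !inE andbT.
rewrite -prod_nat_const; apply: leq_prod => i ij.
by rewrite ffunE (negbTE ij).
Qed.

(** Translating the rectangle by h only changes the points within h_j of a face
    orthogonal to the j-th axis, for some j. *)
Lemma sum_rect_shift_le g (M : R) p q L h : (forall x, `|g x| <= M) ->
    (forall i, q i - p i <= L)%N ->
  `|\sum_(x <- rect p q) g (x + h) - \sum_(x <- rect p q) g x|
    <= 2 * M * ((\sum_j h j) * L ^ d.-1)%:R.
Proof.
move=> gM qpL; rewrite sum_rect_shift.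
have M0 : 0 <= M by apply: le_trans (gM 0).
set X := rect p q; set Y := rect (p + h) (q + h).
have XY : #|` X| = #|` Y|.
  by rewrite !card_rect; apply: eq_bigr => j _; coord_lia j.
have cX : (#|` (X `\` Y)%fset| <= (\sum_j h j) * L ^ d.-1)%N.
  rewrite big_distrl /=.
  apply: (@leq_trans (\sum_j #|` [fset x in X | x j <= p j + h j]%fset|)%N);
    last first.
    by apply: leq_sum => j _; exact: card_rect_slab.
  have -> : (X `\` Y)%fset =
      [fset x in X | [exists j, x j <= p j + h j]%N]%fset.
    apply/fsetP => x; rewrite !inE andbC /=.
    case: (boolP (x \in X)) => //= /rectP xX.
    apply/idP/existsP => [/rectP /existsNP[j xj]|[j xj]].
      exists j; have := xX j; move/negP: xj; coord_lia j.
    apply/negP => /rectP/(_ j); move: xj; coord_lia j.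
  rewrite -sum1_size big_fset /= big_mkcond /=.
  under [leqRHS]eq_bigr do rewrite -sum1_size big_fset /= big_mkcond /=.
  rewrite exchange_big /=; apply: leq_sum => x _.
  case: ifP => // /existsP[j xj].
  by rewrite (bigD1 j) //= xj.
have -> : \sum_(x <- Y) g x - \sum_(x <- X) g x =
          \sum_(x <- (Y `\` X)%fset) g x - \sum_(x <- (X `\` Y)%fset) g x.
  rewrite (big_fsetID _ (mem X) Y) (big_fsetID _ (mem Y) X) /=.
  have -> : [fset x in Y | x \in X]%fset = [fset x in X | x \in Y]%fset.
    by apply/fsetP => x; rewrite !inE andbC.
  have -> : [fset x in Y | x \notin X]%fset = (Y `\` X)%fset.
    by apply/fsetP => x; rewrite !inE andbC.
  have -> : [fset x in X | x \notin Y]%fset = (X `\` Y)%fset.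
    by apply/fsetP => x; rewrite !inE andbC.
  by rewrite opprD addrACA subrr add0r.
have cY : #|` (Y `\` X)%fset| = #|` (X `\` Y)%fset|.
  by rewrite !cardfsD XY fsetIC.
apply: le_trans (ler_normB _ _) _.
have -> : 2 * M = M + M by rewrite mulr_natl mulr2n.
rewrite mulrDl; apply: lerD; apply: le_trans (normr_sum_fset _ gM) _;
  by rewrite ?cY mulrC ler_wpM2l // ler_nat.
Qed.

End sums.

(** * Van der Corput's inequality *)

Section vdc.
Context {R : realType} {d : nat}.
Implicit Types (p q b m h : vec d).

Lemma cauchy_schwarz_fset (T : choiceType) (X : {fset T}) (Y : T -> R) :
  (\sum_(x <- X) Y x) ^+ 2 <= #|` X|%:R * \sum_(x <- X) Y x ^+ 2.
Proof.
have [->|X0] := eqVneq X fset0; first by rewrite !big_seq_fset0 expr0n cardfs0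
    mul0r.
set n : R := _%:R; set S := \sum_(x <- X) Y x.
have n0 : 0 < n by rewrite ltr0n cardfs_gt0.
have : 0 <= \sum_(x <- X) (Y x - S / n) ^+ 2 by apply: sumr_ge0 => x _;
    exact: sqr_ge0.
have -> : \sum_(x <- X) (Y x - S / n) ^+ 2 = \sum_(x <- X) Y x ^+ 2 - S ^+
    2 / n.
  under eq_bigr do rewrite sqrrB.
  rewrite big_split /= sumrB sum_fset_const sumrMnl -mulr_suml -/S -/n.
  by field; rewrite gt_eqF.
by rewrite subr_ge0 ler_pdivrMr // mulrC.
Qed.

(** Averaging over the shifts (t, ..., t), t < H, changes the sum over the
    rectangle by a boundary term, and Cauchy-Schwarz bounds the result by a sum
    of squares.  That sum is monotone in the domain, so it can be extended from
    the rectangle between p and q to the whole box of side L at b, along which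
    equidistribution is known. *)
Lemma van_der_corput (X : vec d -> R) (M : R) p q b (L H : nat) :
    (forall x, `|X x| <= M) ->
    (forall i, b i <= p i)%N -> (forall i, q i <= b i + L)%N ->
  (H%:R * \sum_(x <- rect p q) X x) ^+ 2 <=
    2 * (2 * M * (H * (d * H * L ^ d.-1))%:R) ^+ 2 +
    2 * (L ^ d)%:R *
      \sum_(x <- rect b (b + diagv d L)) (\sum_(t < H) X (x + diagv d t)) ^+ 2.
Proof.
move=> XM bp qb; set T := \sum_(x <- rect p q) X x.
have M0 : 0 <= M by apply: le_trans (XM 0).
pose Y x := \sum_(t < H) X (x + diagv d t).
pose E := \sum_(t < H) (\sum_(x <- rect p q) X (x + diagv d t) - T).
have -> : H%:R * T = - E + \sum_(x <- rect p q) Y x.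
  rewrite /E sumrB [X in _ = _ + X]exchange_big /= opprB subrK.
  by rewrite sumr_const card_ord mulr_natl.
have E2 : E ^+ 2 <= (2 * M * (H * (d * H * L ^ d.-1))%:R) ^+ 2.
  rewrite -real_normK ?num_real// lerXn2r ?nnegrE//; first by rewrite !mulr_ge0.
  apply: le_trans (ler_norm_sum _ _ _) _.
  have -> : 2 * M * (H * (d * H * L ^ d.-1))%:R =
      \sum_(t < H) 2 * M * (d * H * L ^ d.-1)%:R.
    rewrite sumr_const card_ord -[RHS]mulr_natl (natrM _ H).
    by rewrite [LHS]mulrCA.
  apply: ler_sum => t _.
  apply: le_trans (sum_rect_shift_le (L := L) _ XM _) _.
    by move=> i; have := bp i; have := qb i; lia.
  rewrite ler_wpM2l ?mulr_ge0// ler_nat leq_mul2r; apply/orP; right.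
  under eq_bigr do rewrite ffunE.
  by rewrite sum_nat_const card_ord leq_mul2l ltnW ?orbT.
have S2 : (\sum_(x <- rect p q) Y x) ^+ 2 <=
    (L ^ d)%:R * \sum_(x <- rect b (b + diagv d L)) Y x ^+ 2.
  have sub := rect_sub_box bp qb.
  apply: le_trans (cauchy_schwarz_fset _ _) _; apply: ler_pM => //.
  - by apply: sumr_ge0 => x _; exact: sqr_ge0.
  - by rewrite ler_nat -(card_box b); apply: card_fset_le; apply/fsubsetP.
  - by apply: sum_fset_le => // x; exact: sqr_ge0.
have : (- E + \sum_(x <- rect p q) Y x) ^+ 2 <=
  2 * E ^+ 2 + 2 * (\sum_(x <- rect p q) Y x) ^+ 2.
  have := sqr_ge0 (E + \sum_(x <- rect p q) Y x); nra.
move=> /le_trans; apply; apply: lerD; first by rewrite ler_wpM2l.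
by rewrite -mulrA ler_wpM2l.
Qed.
End vdc.

(** * Integration of continuous functions against Haar measure *)

Section haar.
Context {R : realType} {K : topologicalZmodType}.
Hypothesis cK : compact [set: K].
Variable mu : probability [the measurableType _ of borel K] R.
Implicit Types (f g : K -> R).

Lemma borel_open (U : set K) : open U -> measurable (U : set (borel K)).
Proof. exact: sub_sigma_algebra. Qed.

Lemma borel_closed (U : set K) : closed U -> measurable (U : set (borel K)).
Proof.
move=> cU; rewrite -[U]setCK; apply: measurableC.
by apply: borel_open; exact: closed_openC.
Qed.

Lemma continuous_measurable f : continuous f ->
  measurable_fun setT (f : borel K -> R).
Proof.
move=> cf; apply: (measurability _ (measurable_realfun.RGenOpens.measurableE
  R)).
move=> _ [_ [a [b ->] <-]]; rewrite setTI.
apply: borel_open; by apply: open_comp.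
Qed.

Lemma continuous_bounded f : continuous f -> exists2 M : R, 0 < M & forall x,
    `|f x| <= M.
Proof.
move=> cf.
have /compact_bounded : compact (f @` setT).
  by apply: continuous_compact => //; apply: continuous_subspaceT.
move=> [M [_ HM]]; exists (Num.max 1 (M + 1)); first by rewrite lt_max ltr01.
move=> x; apply: HM; last by exists x.
by rewrite lt_max ltrDl ltr01 orbT.
Qed.

Lemma bounded_integrable f (M : R) : measurable_fun setT (f : borel K -> R) ->
  (forall x, `|f x| <= M) -> mu.-integrable setT (EFin \o f).
Proof.
move=> mf fM; apply: measurable_bounded_integrable => //.
  exact: le_lt_trans (probability_le1 mu (@measurableT _ _)) (ltry 1).
exists M; split; first exact: num_real.
by move=> r Mr x _ /=; apply: le_trans (fM x) (ltW Mr).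
Qed.

Lemma continuous_integrable f : continuous f -> mu.-integrable setT (EFin \o f).
Proof.
move=> cf; have [M _ fM] := continuous_bounded cf.
by apply: (@bounded_integrable _ M) => //; exact: continuous_measurable.
Qed.

Lemma continuous_fsum (I : Type) (r : seq I) (F : I -> K -> R) :
  (forall i, continuous (F i)) -> continuous (fun x => \sum_(i <- r) F i x).
Proof.
move=> cF; elim: r => [|i r IH] x.
  by under eq_fun do rewrite big_nil; exact: cvg_cst.
by under eq_fun do rewrite big_cons; apply: cvgD; [exact: cF|exact: IH].
Qed.

Lemma integrable_fsum (I : Type) (r : seq I) (F : I -> K -> R) :
  (forall i, mu.-integrable setT (EFin \o (F i : borel K -> R))) ->
  mu.-integrable setT (EFin \o ((fun x => \sum_(i <- r) F i x) : borel K -> R)).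
Proof.
move=> iF; elim: r => [|i r IH].
  apply: continuous_integrable; under eq_fun do rewrite big_nil.
  by move=> x; exact: cvg_cst.
apply: eq_integrable (integrableD _ (iF i) IH) => // x _ /=.
by rewrite big_cons.
Qed.

Lemma Rintegral_fsum (I : Type) (r : seq I) (F : I -> K -> R) :
  (forall i, mu.-integrable setT (EFin \o (F i : borel K -> R))) ->
  \int[mu]_x (\sum_(i <- r) F i x) = \sum_(i <- r) \int[mu]_x F i x.
Proof.
move=> iF; elim: r => [|i r IH].
  under eq_Rintegral do rewrite big_nil.
  by rewrite big_nil Rintegral_cst// mul0r.
under eq_Rintegral do rewrite big_cons.
by rewrite RintegralD// ?IH ?big_cons//; exact: integrable_fsum.
Qed.

Lemma integrableD_real f g : mu.-integrable setT (EFin \o (f : borel K -> R)) ->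
  mu.-integrable setT (EFin \o (g : borel K -> R)) ->
  mu.-integrable setT (EFin \o ((fun x => f x + g x) : borel K -> R)).
Proof. by move=> if_ ig; exact: eq_integrable (integrableD _ if_ ig). Qed.

Lemma integrableB_real f g : mu.-integrable setT (EFin \o (f : borel K -> R)) ->
  mu.-integrable setT (EFin \o (g : borel K -> R)) ->
  mu.-integrable setT (EFin \o ((fun x => f x - g x) : borel K -> R)).
Proof. by move=> if_ ig; exact: eq_integrable (integrableB _ if_ ig). Qed.

Lemma integrableZ_real f (c : R) : mu.-integrable setT
    (EFin \o (f : borel K -> R)) ->
  mu.-integrable setT (EFin \o ((fun x => c * f x) : borel K -> R)).
Proof. by move=> if_; exact: eq_integrable (integrableZl _ c if_). Qed.

Lemma Rintegral_const (c : R) : \int[mu]_x c = c.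
Proof.
have muT : fine (mu setT) = 1 by rewrite probability_setT.
by rewrite Rintegral_cst// muT mulr1.
Qed.

Lemma le_Rintegral_continuous f g : continuous f -> continuous g ->
    (forall x, f x <= g x) ->
  \int[mu]_x f x <= \int[mu]_x g x.
Proof.
move=> cf cg fg; apply: le_Rintegral => //; exact: continuous_integrable.
Qed.

Lemma normr_Rintegral_le f (M : R) : mu.-integrable setT
    (EFin \o (f : borel K -> R)) ->
  (forall x, `|f x| <= M) -> `|\int[mu]_x f x| <= M.
Proof.
move=> if_ fM; apply: le_trans (le_normr_Rintegral _ if_) _ => //.
rewrite -[leRHS]Rintegral_const; apply: le_Rintegral => //;
  first exact: integrable_norm.
by apply: continuous_integrable => x; exact: cvg_cst.
Qed.

Hypothesis hmu : is_haar mu.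

Lemma continuous_addl (a : K) : continuous (fun x => a + x).
Proof.
move=> x; apply: (@continuous_comp K (K * K)%type K (fun x => (a, x))
  (fun z => z.1 + z.2)); last exact: add_continuous.
by apply: cvg_pair; [exact: cvg_cst|exact: cvg_id].
Qed.

Lemma Rintegral_translate f (a : K) : continuous f ->
  \int[mu]_x f (a + x) = \int[mu]_x f x.
Proof.
move=> cf.
have mphi : measurable_fun setT ((fun x => a + x) : borel K -> borel K).
  apply: (@measurability _ _ [the measurableType _ of borel K]
    [the measurableType _ of borel K] setT _ (@open K)) => //.
  move=> _ [U oU <-]; rewrite setTI; apply: borel_open.
  by apply: open_comp => // ? _; exact: continuous_addl.
rewrite /Rintegral; congr fine.
rewrite -(integral_pushforward mphi (mu := mu) (D := setT) (f := EFin \o f))//=.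
- apply: eq_measure_integral => A mA _.
  rewrite /= /pushforward; case: hmu => /(_ (- a) A mA) <- _ _; congr (mu _).
  apply/seteqP; split => x /=.
    by move=> Aax; exists (a + x) => //; rewrite addKr.
  by move=> [y Ay <-]; rewrite addNKr.
- by apply/measurable_EFinP; exact: continuous_measurable.
- rewrite preimage_setT; apply: (@continuous_integrable (fun x => f (a + x))).
  by move=> x; apply: continuous_comp; [exact: continuous_addl|exact: cf].
Qed.

Lemma uniformly_continuous_translate f (e : R) : continuous f -> 0 < e ->
  \forall v \near (0 : K), forall x, `|f (v + x) - f x| <= e.
Proof.
move=> cf e0.
have := (iffLR (compact_near_coveringP _) cK) _ (nbhs (0 : K))
  (fun v x => `|f (v + x) - f x| <= e) _.
have H : forall x, [set: K] x ->
   \forall x' \near x & i \near (0 : K), `|f (i + x') - f x'| <= e.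
  move=> x _.
  have c : continuous (fun z : K * K => f (z.2 + z.1) - f z.1).
    move=> z; apply: cvgB.
      apply: (@continuous_comp (K * K)%type K R (fun z => z.2 + z.1) f);
        last exact: cf.
      apply: (@continuous_comp (K * K)%type (K * K)%type K (fun z => (z.2, z.1))
        (fun z => z.1 + z.2)); last exact: add_continuous.
      by apply: cvg_pair; [exact: cvg_snd|exact: cvg_fst].
    by apply: (@continuous_comp (K * K)%type K R (fun z => z.1) f);
      [exact: cvg_fst|exact: cf].
  have := c (x, 0); rewrite /continuous_at /= add0r subrr => /cvgr0_norm_le
      /(_ _ e0).
  by [].
move=> /(_ _ H); apply: filterS => v Hv x; exact: Hv.
Qed.

Lemma open_translate (V : set K) (a : K) : open V -> open [set a + x | x in V].
Proof.
have -> : [set a + x | x in V] = (fun x => - a + x) @^-1` V.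
  apply/seteqP; split => x /=; first by move=> [y Vy <-]; rewrite addKr.
  by move=> Vx; exists (- a + x) => //; rewrite addNKr.
by move=> oV; apply: open_comp => // ? _; exact: continuous_addl.
Qed.

(** The open cover form of compactness is stated for pointed spaces; K is
    pointed at 0. *)
Lemma finite_translates (V : set K) : open V -> V 0 ->
  exists D : {fset K}, [set: K] `<=` \bigcup_(a in [set` D])
    [set a + x | x in V].
Proof.
move=> oV V0.
pose PK : ptopologicalType := HB.pack (K : Type) (isPointed.Build K (0 : K))
  (TopologicalZmodule.on K).
have cK' : @cover_compact PK [set: K] by rewrite -(@compact_cover PK).
have [||D _ KD] := cK' K setT (fun a => [set a + x | x in V]).
- by move=> a _; exact: open_translate.
- by move=> x _; exists x => //; exists 0 => //; rewrite addr0.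
by exists D.
Qed.

(** Finitely many translates of V cover K; if V were null, so would be K. *)
Lemma haar_open_gt0 (V : set K) : open V -> V 0 ->
    (0 < mu (V : set (borel K)))%E.
Proof.
move=> oV V0; have [D KD] := finite_translates oV V0.
rewrite lt_neqAle measure_ge0 andbT; apply/eqP => V00.
have : (mu setT <= \sum_(a \in [set` D]) mu [set (a + x)%R | x in V])%E.
  apply: content_sub_fsum => //.
  by move=> a _; apply: borel_open; exact: open_translate.
rewrite fsbig1.
  have -> : mu setT = 1%E by rewrite probability_setT.
  by rewrite lee_fin ler10.
by move=> a _; case: hmu => -> //; exact: borel_open.
Qed.

Lemma Rintegral_indic (A : set K) : measurable (A : set (borel K)) ->
  \int[mu]_x \1_A x = fine (mu (A : set (borel K))).
Proof. by move=> mA; rewrite /Rintegral integral_indic// setIT. Qed.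

Lemma indic_integrable (A : set K) : measurable (A : set (borel K)) ->
  mu.-integrable setT (EFin \o (\1_A : borel K -> R)).
Proof.
move=> mA; apply: (@bounded_integrable _ 1).
  exact: measurable_indic.
by move=> x; rewrite indicE; case: (_ \in _); rewrite ?normr1 ?normr0.
Qed.

(** Passage from L^2 to pointwise bounds, uniformly over all S that vary no
    faster than f: if |S 0| > e then |S| > e / 2 on a neighbourhood of 0 that
    depends on f and e only, and this neighbourhood has positive measure. *)
Lemma small_L2_small_at0 f (e : R) : continuous f -> 0 < e ->
  exists2 r : R, 0 < r & forall S : K -> R, continuous S ->
    (forall v, (forall x, `|f (v + x) - f x| <= e / 2) -> `|S v - S 0| <= e / 2)
      ->
    \int[mu]_x (S x ^+ 2) <= r -> `|S 0| <= e.
Proof.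
move=> cf e0; have e20 : 0 < e / 2 by rewrite divr_gt0.
have := uniformly_continuous_translate cf e20; rewrite /prop_near1 nbhsE =>
    -[V [oV V0] VE].
have muV := haar_open_gt0 oV V0.
have mV := borel_open oV.
have fV : 0 < fine (mu (V : set (borel K))).
  by apply: fine_gt0; rewrite muV/= (le_lt_trans (probability_le1 mu mV)) ?ltry.
exists ((e / 2) ^+ 2 * fine (mu (V : set (borel K)))).
  by rewrite mulr_gt0// exprn_gt0.
move=> S cS SV; rewrite leNgt => Sr; rewrite leNgt; apply/negP => eS;
  move/negP: Sr; apply.
(* |S| is at least c on V, and c > e / 2. *)
pose c : R := `|S 0| - e / 2.
have c0 : e / 2 < c by rewrite /c ltrBrDr -splitr.
apply: (@lt_le_trans _ _ (c ^+ 2 * fine (mu (V : set (borel K))))).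
  by rewrite ltr_pM2r// ltrXn2r ?nnegrE// ?ltW// (lt_trans e20).
rewrite -Rintegral_indic// -RintegralZl//; last exact: indic_integrable.
apply: le_Rintegral => //.
- apply: (@bounded_integrable _ (c ^+ 2)).
    by apply: measurable_funM => //; exact: measurable_indic.
  move=> x; rewrite normrM ger0_norm ?sqr_ge0// indicE.
  by case: (_ \in _); rewrite ?normr1 ?normr0 ?mulr1// mulr0 sqr_ge0.
- by apply: continuous_integrable => x; apply: cvgM; exact: cS.
move=> x _; rewrite indicE; have [|_] := boolP (x \in V);
  last by rewrite mulr0 sqr_ge0.
rewrite inE => Vx; rewrite mulr1.
have cSx : c <= `|S x|.
  have := SV x (VE x Vx); rewrite /c distrC => h.
  by rewrite lerBlDr -lerBlDl; apply: le_trans h; exact: lerB_dist.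
have c0' : 0 <= c by rewrite ltW// (lt_trans e20).
by rewrite -[leRHS]real_normK ?num_real// lerXn2r ?nnegrE.
Qed.
End haar.

(** * Averages over boxes *)

Section avg.
Context {R : realType} {d : nat}.
Implicit Types (m : vec d) (g : vec d -> R).

Lemma box_avgD g1 g2 m N :
  box_avg (fun x => g1 x + g2 x) m N = box_avg g1 m N + box_avg g2 m N.
Proof. by rewrite !box_avgE big_split mulrDl. Qed.

Lemma box_avgZ (c : R) g m N : box_avg (fun x => c * g x) m N = c * box_avg g m
    N.
Proof. by rewrite !box_avgE -mulr_sumr mulrA. Qed.

Lemma box_avgB g1 g2 m N :
  box_avg (fun x => g1 x - g2 x) m N = box_avg g1 m N - box_avg g2 m N.
Proof. by rewrite !box_avgE sumrB mulrBl. Qed.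

Lemma box_avg_sum (I : Type) (r : seq I) (G : I -> vec d -> R) m N :
  box_avg (fun x => \sum_(i <- r) G i x) m N = \sum_(i <- r) box_avg (G i) m N.
Proof.
by rewrite box_avgE exchange_big mulr_suml; apply: eq_bigr => i _;
  rewrite box_avgE.
Qed.

Lemma box_avg_const (c : R) m N : (0 < N)%N -> box_avg (fun=> c) m N = c.
Proof.
move=> N0; rewrite box_avgE sum_fset_const card_box natrX mulrC mulKf//.
by rewrite expf_neq0// pnatr_eq0 -lt0n.
Qed.

Lemma le_box_avg g1 g2 m N : (forall x, g1 x <= g2 x) ->
  box_avg g1 m N <= box_avg g2 m N.
Proof.
move=> g12; rewrite !box_avgE ler_wpM2r ?invr_ge0 ?exprn_ge0//.
by apply: ler_sum.
Qed.

Lemma box_avg_close g1 g2 (e : R) m N : (0 < N)%N ->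
    (forall x, `|g1 x - g2 x| <= e) ->
  `|box_avg g1 m N - box_avg g2 m N| <= e.
Proof.
move=> N0 g12; rewrite -box_avgB ler_norml; apply/andP.
split; [rewrite -(box_avg_const (- e) m N0)|rewrite -[leRHS](box_avg_const e m
  N0)];
  by apply: le_box_avg => x; have := g12 x; rewrite ler_norml => /andP[].
Qed.

Lemma box_avg_shift (hd : (0 < d)%N) g (M : R) m N h :
  (0 < N)%N -> (forall x, `|g x| <= M) ->
  `|box_avg (fun x => g (x + h)) m N - box_avg g m N| <= 2 * M * (\sum_j h j)%:R
    / N%:R.
Proof.
move=> N0 gM; rewrite !box_avgE -mulrBl normrM normfV normrX normr_nat.
have N1 : (0 : R) < N%:R by rewrite ltr0n.
rewrite ler_pdivrMr ?exprn_gt0//.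
apply: le_trans (@sum_rect_shift_le _ _ g M _ _ N h gM _) _.
  by move=> j; rewrite vecD ffunE addnC addnK.
have -> : N%:R ^+ d = N%:R * N%:R ^+ d.-1 :> R by rewrite -exprS prednK.
by rewrite natrM natrX -!mulrA mulKf// gt_eqF.
Qed.
End avg.

Lemma level_count_close (R : realType) (eta : R) (k : nat) (y : R) :
  0 < eta -> y <= k%:R * eta -> - eta <= y ->
  `|eta * \sum_(i < k) (i%:R * eta < y)%R%:R - y| <= eta.
Proof.
move=> eta0 yk ye.
suff H : (y <= 0 -> \sum_(i < k) (i%:R * eta < y)%R%:R = 0 :> R) /\
   (0 < y -> y <= eta * \sum_(i < k) (i%:R * eta < y)%R%:R < y + eta).
  have [y0|y0] := leP y 0.
    by rewrite H.1// mulr0 sub0r normrN ler0_norm// lerNl.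
  have /andP[h1 h2] := H.2 y0.
  by rewrite ler_norml; apply/andP; split; lra.
elim: k y yk {ye} => [|k IH] y yk.
  by rewrite mul0r in yk; split => y0; rewrite ?big_ord0//; lra.
have yk' : y - eta <= k%:R * eta by move: yk; rewrite -natr1; lra.
have [IH1 IH2] := IH _ yk'.
have E : \sum_(i < k) ((bump 0 i)%:R * eta < y)%R%:R = \sum_(i < k)
    (i%:R * eta < y - eta)%R%:R :> R.
  by apply: eq_bigr => i _; rewrite /bump/= add1n -natr1 mulrDl mul1r ltrBrDr.
split=> y0; rewrite big_ord_recl mul0r E.
  by rewrite IH1; [rewrite ltNge y0 addr0 | lra].
rewrite y0 mulrDr mulr1; have [ye|ye] := leP y eta.
  by rewrite IH1 ?mulr0 ?addr0; [apply/andP; split; lra | lra].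
have /andP[h1 h2] : y - eta <= eta * \sum_(i < k) (i%:R * eta < y - eta)%R%:R <
    y - eta + eta.
  by apply: IH2; lra.
by apply/andP; split; lra.
Qed.

(** * Equidistribution and continuous functions *)

Section ud.
Context {R : realType} {K : topologicalZmodType}.
Hypothesis cK : compact [set: K].
Variable mu : probability [the measurableType _ of borel K] R.
Context {d : nat}.
Implicit Types (f g : K -> R) (B : set (vec d)).

(** Uniform distribution for B = {0} and well distribution for B = N^d. *)
Definition ud_on B (v : vec d -> K) := forall U : set K, open U ->
  mu (boundary U : set (borel K)) = 0%E -> forall e : R, 0 < e ->
  \forall N \near \oo, forall m, B m ->
    `|box_freq R (v @^-1` U) m N - fine (mu (U : set (borel K)))| <= e.

(** Only countably many level sets of f have positive measure, so the equally
    spaced levels can be translated away from them. *)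
Lemma null_levels f (eta M : R) k : continuous f -> 0 < eta ->
  exists2 s : R, 0 < s < eta & forall i, (i < k)%N ->
    mu ([set x | f x = i%:R * eta + (s - M)] : set (borel K)) = 0%E.
Proof.
move=> cf eta0; apply: contrapT => H.
pose X : {RV mu >-> R} :=
    HB.pack (f : borel K -> R)
    (isMeasurableFun.Build _ _ _ _ _ (continuous_measurable cf)).
have cD := pmf_gt0_countable X.
pose D := [set r | 0 < pmf X r].
have sub : `]0, eta[%classic `<=` \bigcup_i
    ((fun t => t - i%:R * eta + M) @` D).
  move=> s /= /[!in_itv]/= s0; apply: contrapT => nD; apply: H;
    exists s => // i ik.
  apply: contrapT => /eqP mu0; apply: nD; exists i => //;
    exists (i%:R * eta + (s - M)); last by ring.
  rewrite /D /= /pmf fine_gt0// lt0e mu0 measure_ge0 /= -ge0_fin_numE//.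
  apply: fin_num_measure; apply: borel_closed; exact: closed_comp.
have c : countable (\bigcup_i ((fun t => t - i%:R * eta + M) @` D)).
  by apply: bigcup_countable => // i _; exact: card_le_trans (card_image_le _ _)
    cD.
have := countable_lebesgue_measure0 (sub_countable (subset_card_le sub) c).
rewrite lebesgue_measure_itv/= lte_fin eta0 sube0 => -[] /eqP.
by rewrite gt_eqF.
Qed.

(** f is uniformly within eta of eta times the number of levels below it.  The
    superlevel sets involved are open, with boundary inside a level set, which
    is null for a good choice of the levels. *)
Lemma ud_on_continuous B (w : vec d -> K) f : ud_on B w -> continuous f ->
  forall e : R, 0 < e -> \forall N \near \oo, forall m, B m ->
    `|box_avg (fun n => f (w n)) m N - \int[mu]_x f x| <= e.
Proof.
move=> udw cf e e0; have [M M0 fM] := continuous_bounded cK cf.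
pose eta : R := e / 4.
have eta0 : 0 < eta by rewrite divr_gt0.
have [k kM] : exists k, 2 * M <= k%:R * eta.
  exists (Num.truncn (2 * M / eta)).+1.
  by rewrite -ler_pdivrMr// ltW// truncnS_gt.
have [s /andP[s0 se] sU] := null_levels M k cf eta0.
pose U (i : nat) : set K := [set x | i%:R * eta + (s - M) < f x].
have oU i : open (U i).
  have -> : U i = f @^-1` [set t | i%:R * eta + (s - M) < t] by [].
  by apply: open_comp; [move=> x _; exact: cf|exact: open_gt].
have bU i : (i < k)%N -> mu (boundary (U i) : set (borel K)) = 0%E.
  move=> ik; apply/eqP; rewrite eq_le measure_ge0 andbT -(sU i ik).
  have cU : closed [set x | f x = i%:R * eta + (s - M)].
    have -> : [set x | f x = i%:R * eta + (s - M)] =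
        f @^-1` [set i%:R * eta + (s - M)] by [].
    exact: closed_comp.
  apply: le_measure; rewrite ?inE.
  - by apply: measurableD;
      [apply: borel_closed; exact: closed_closure|apply: borel_open;
      exact: open_interior].
  - exact: borel_closed.
  move=> x [clx nIx] /=.
  have nUx : ~ U i x by move=> Ux; apply: nIx;
      exact: open_nbhs_nbhs (conj (oU i) Ux).
  apply/eqP; rewrite eq_le leNgt; apply/andP; split; first exact/negP.
  have cl : closed [set x | i%:R * eta + (s - M) <= f x].
    have -> : [set x | i%:R * eta + (s - M) <= f x] =
        f @^-1` [set t | i%:R * eta + (s - M) <= t] by [].
    by apply: closed_comp => //; exact: closed_ge.
  have Ucl : U i `<=` [set x | i%:R * eta + (s - M) <= f x] by move=> y;
      exact: ltW.
  by have := closureS Ucl clx; rewrite -(iffLR (closure_id _) cl).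
pose g (x : K) : R := eta * \sum_(i < k) \1_(U i) x.
have fg x : `|g x - (f x + (M - s))| <= eta.
  have -> : g x = eta * \sum_(i < k) (i%:R * eta < f x + (M - s))%R%:R.
    congr (_ * _); apply: eq_bigr => i _; rewrite indicE;
      congr (nat_of_bool _)%:R.
    by apply/idP/idP; rewrite inE /U /= => h; lra.
  have := fM x; rewrite ler_norml => /andP[h1 h2].
  by apply: level_count_close => //; lra.
have iU (i : 'I_k) : mu.-integrable setT (EFin \o (\1_(U i) : borel K -> R)).
  by apply: indic_integrable; exact: borel_open.
have ig : mu.-integrable setT (EFin \o (g : borel K -> R)).
  by apply: integrableZ_real; exact: integrable_fsum.
have intg : \int[mu]_x g x = eta * \sum_(i < k) fine (mu (U i : set (borel K))).
  rewrite RintegralZl//; last exact: integrable_fsum.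
  rewrite Rintegral_fsum//; congr (_ * _); apply: eq_bigr => i _.
  by rewrite Rintegral_indic//; exact: borel_open.
have intfg : `|\int[mu]_x g x - (\int[mu]_x f x + (M - s))| <= eta.
  have ic : mu.-integrable setT (EFin \o ((fun=> M - s) : borel K -> R)).
    by apply: continuous_integrable => // x; exact: cvg_cst.
  have if_ := continuous_integrable cK mu cf.
  have -> : \int[mu]_x f x + (M - s) = \int[mu]_x (f x + (M - s))
      by rewrite RintegralD// Rintegral_const.
  rewrite -RintegralB//; last first.
    exact: integrableD_real.
  apply: normr_Rintegral_le => //.
  by apply: integrableB_real => //; exact: integrableD_real.
(* k errors dl, each with factor eta, add up to at most e / 4. *)
pose dl : R := e / (4 * (eta * k.+1%:R)).
have dl0 : 0 < dl by rewrite divr_gt0// mulr_gt0// mulr_gt0.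
have H : \forall N \near \oo, forall i : 'I_k, forall m, B m ->
    `|box_freq R (w @^-1` U i) m N - fine (mu (U i : set (borel K)))| <= dl.
  by apply: filter_forall => i; apply: udw => //; exact: bU.
near=> N => m Bm.
have N0 : (0 < N)%N by near: N; exact: nbhs_infty_gt.
have HN : forall i : 'I_k, forall m, B m ->
    `|box_freq R (w @^-1` U i) m N - fine (mu (U i : set (borel K)))| <= dl.
  by near: N.
have avg1 : `|box_avg (fun n => g (w n)) m N - (box_avg (fun n => f (w n)) m N +
    (M - s))| <= eta.
  have -> : box_avg (fun n => f (w n)) m N + (M - s) =
      box_avg (fun n => f (w n) + (M - s)) m N.
    by rewrite box_avgD box_avg_const.
  by apply: box_avg_close.
have avg2 : `|box_avg (fun n => g (w n)) m N - \int[mu]_x g x| <= e / 4.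
  rewrite /g box_avgZ box_avg_sum intg -mulrBr -sumrB normrM gtr0_norm//.
  apply: (@le_trans _ _ (eta * (k%:R * dl))).
    rewrite ler_wpM2l ?(ltW eta0)//; apply: le_trans (ler_norm_sum _ _ _) _.
    rewrite mulr_natl -[k in leRHS]card_ord -sumr_const; apply: ler_sum => i _.
    have := HN i _ Bm; rewrite box_freqE.
    have -> // : (\1_(w @^-1` U i) : vec d -> R) = (fun n => \1_(U i) (w n)).
    by apply/funext => n; rewrite !indicE; congr (nat_of_bool _)%:R;
      apply/idP/idP; rewrite !inE.
  have -> : eta * (k%:R * dl) = e / 4 * (k%:R / k.+1%:R).
    have : k.+1%:R != 0 :> R by rewrite pnatr_eq0.
    by rewrite /dl /eta; move: (k.+1%:R) => q q0; field; rewrite q0 gt_eqF.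
  rewrite ler_piMr// ?divr_ge0 ?(ltW e0)//.
  by rewrite ler_pdivrMr// mul1r ler_nat.
move: avg1 avg2 intfg; rewrite !ler_norml /eta => /andP[? ?] /andP[? ?]
  /andP[? ?].
by apply/andP; split; lra.
Unshelve. all: by end_near. Qed.
End ud.

Section regularity.
Context {R : realType} {K : topologicalZmodType}.
Hypothesis cK : compact [set: K].
Hypothesis hK : hausdorff_space K.
Variable mu : probability [the measurableType _ of borel K] R.
Hypothesis hmu : is_haar mu.
Context {d : nat}.
Implicit Types (f g : K -> R) (B : set (vec d)).

Lemma urysohn_between (C U : set K) : closed C -> open U -> C `<=` U ->
  exists2 f : K -> R, continuous f & forall x, \1_C x <= f x <= \1_U x.
Proof.
move=> cC oU CU.
have cU : closed (~` U) by exact: open_closedC.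
have dis : ~` U `&` C = set0 by rewrite setIC; apply/disjoints_subset;
    rewrite setCK.
have := iffLR (normal_separatorP (T := K) (R := R)) (compact_normal hK cK) _ _
    cU cC dis.
move=> /(uniform_separatorP (R := R))[f [cf f01 f0 f1]]; exists f => // x.
have /= /[!in_itv]/= /andP[x0 x1] : `[0, 1]%classic (f x) by apply: f01;
    exists x.
rewrite !indicE; apply/andP; split.
  have [/set_mem Cx|_ //] := boolP (x \in C).
  by have /= -> : [set 1 : R] (f x) by apply: f1; exists x.
have [_ //|/negP Ux] := boolP (x \in U).
have /= -> // : [set 0 : R] (f x).
by apply: f0; exists x => // Ux'; apply: Ux; rewrite inE.
Qed.

(** Regularity squeezes U between a compact C and an open V containing the
    closure of U, with measures within e / 2 of that of U because the boundary
    is null; the averages of two Urysohn functions then bracket the frequency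
    of U. *)
Lemma ud_on_of_continuous B (v : vec d -> K) :
  (forall f, continuous f -> forall e : R, 0 < e ->
    \forall N \near \oo, forall m, B m ->
    `|box_avg (fun n => f (v n)) m N - \int[mu]_x f x| <= e) ->
  ud_on mu B v.
Proof.
move=> H U oU bU e e0.
have e20 : 0 < e / 2 by rewrite divr_gt0.
have mU := borel_open oU.
have mcU : measurable (closure U : set (borel K)) by apply: borel_closed;
    exact: closed_closure.
have fin A : measurable (A : set (borel K)) ->
    mu (A : set (borel K)) \is a fin_num.
  exact: fin_num_measure.
have mucU : (mu (closure U : set (borel K)) <= mu (U : set (borel K)))%E.
  have -> : mu (U : set (borel K)) =
      (mu (U : set (borel K)) + mu (boundary U : set (borel K)))%E.
    by rewrite bU adde0.
  have mbU : measurable (boundary U : set (borel K)).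
    by apply: measurableD => //; apply: borel_open; exact: open_interior.
  apply: le_trans (measureU2 _ mU mbU).
  apply: le_measure; rewrite ?inE//; first exact: measurableU.
  move=> x clx; have [Ux|nUx] := pselect (U x); [by left|right; split => //].
  by move=> /interior_subset.
have [C [cC CU] muC] : exists2 C : set K, compact C /\ C `<=` U &
    fine (mu (U : set (borel K))) - e / 2 < fine (mu (C : set (borel K))).
  case: hmu => _ _ /(_ U oU) inner.
  have : ((fine (mu (U : set (borel K))) - e / 2)%:E <
      ereal_sup [set mu C | C in [set C : set K | compact C /\
        (C `<=` U)%classic]])%E.
    by rewrite -inner EFinB fineK ?fin// lteBlDr ?lteDl ?fin// lte_fin.
  move=> /ereal_sup_gt[_ [C [cC CU] <-]] lt; exists C => //.
  have mC : measurable (C : set (borel K)) by apply: borel_closed;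
      exact: compact_closed.
  by rewrite -lte_fin fineK ?fin.
have [V [oV UV] muV] : exists2 V : set K, open V /\ closure U `<=` V &
    fine (mu (V : set (borel K))) < fine (mu (U : set (borel K))) + e / 2.
  case: hmu => _ /(_ _ mcU) outer _.
  have : (ereal_inf [set mu V | V
      in [set V : set K | open V /\ (closure U `<=` V)%classic]] <
     (fine (mu (U : set (borel K))) + e / 2)%:E)%E.
    by rewrite -outer; apply: le_lt_trans mucU _;
      rewrite EFinD fineK ?fin// lteDl ?fin ?lte_fin.
  move=> /ereal_inf_lt[_ [V [oV UV] <-]] lt; exists V => //.
  by rewrite -lte_fin fineK ?fin//; exact: borel_open.
have clC : closed C by exact: compact_closed.
have [f1 cf1 f1P] := urysohn_between clC oU CU.
have [f2 cf2 f2P] := urysohn_between (closed_closure (A := U)) oV UV.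
have int1 : fine (mu (C : set (borel K))) <= \int[mu]_x f1 x.
  rewrite -Rintegral_indic; last exact: borel_closed.
  apply: le_Rintegral => //; first by apply: indic_integrable;
    exact: borel_closed.
    exact: continuous_integrable.
  by move=> x _; have /andP[] := f1P x.
have int2 : \int[mu]_x f2 x <= fine (mu (V : set (borel K))).
  rewrite -Rintegral_indic; last exact: borel_open.
  apply: le_Rintegral => //; last by move=> x _; have /andP[] := f2P x.
    exact: continuous_integrable.
  by apply: indic_integrable; exact: borel_open.
near=> N.
have N0 : (0 < N)%N by near: N; exact: nbhs_infty_gt.
have h1 : forall m, B m ->
    `|box_avg (fun n => f1 (v n)) m N - \int[mu]_x f1 x| <= e / 2 by near: N;
      exact: H.
have h2 : forall m, B m ->
    `|box_avg (fun n => f2 (v n)) m N - \int[mu]_x f2 x| <= e / 2 by near: N;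
      exact: H.
move=> m Bm; move: (h1 m Bm) (h2 m Bm) => {}h1 {}h2.
rewrite box_freqE.
have le1 : box_avg (fun n => f1 (v n)) m N <= box_avg (\1_(v @^-1` U)) m N.
  apply: le_box_avg => n; have /andP[_] := f1P (v n); rewrite !indicE =>
    /le_trans; apply.
  by rewrite ler_nat leq_eqVlt; apply/orP; left; apply/eqP; congr nat_of_bool;
    apply/idP/idP; rewrite !inE.
have le2 : box_avg (\1_(v @^-1` U)) m N <= box_avg (fun n => f2 (v n)) m N.
  apply: le_box_avg => n; have /andP[+ _] := f2P (v n); rewrite !indicE => fn;
    apply: le_trans fn.
  rewrite ler_nat; case: (boolP (n \in _)) => //; rewrite inE => Un.
  by rewrite mem_set//; exact: subset_closure.
move: h1 h2; rewrite !ler_norml => /andP[? ?] /andP[? ?].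
by apply/andP; split; lra.
Unshelve. all: by end_near. Qed.
End regularity.

(** * Vanishing of weighted averages *)

Section vdc_main.
Context {R : realType} {K : topologicalZmodType}.
Hypothesis cK : compact [set: K].
Variable mu : probability [the measurableType _ of borel K] R.
Hypothesis hmu : is_haar mu.
Context {d : nat}.
Hypothesis hd : (0 < d)%N.
Variable B : set (vec d).
Variable f : K -> R.
Hypothesis cf : continuous f.
Hypothesis f0 : \int[mu]_x f x = 0.

Lemma continuous_comp_addr (w : K) : continuous (fun z => f (z + w)).
Proof.
move=> z; under eq_fun do rewrite addrC.
by apply: continuous_comp; [exact: continuous_addl|exact: cf].
Qed.

(** Uniformity in z comes from compactness: by uniform continuity of f, the
    bound at one z0 passes to nearby z at the cost of e / 2. *)
Lemma ud_translates (w : vec d -> K) : ud_on mu B w ->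
  forall e : R, 0 < e -> \forall N \near \oo, forall z m, B m ->
  `|box_avg (fun n => f (z + w n)) m N| <= e.
Proof.
move=> udw e e0; have e20 : 0 < e / 2 by rewrite divr_gt0.
have /compact_near_coveringP cov := cK.
have := cov _ \oo (fun N z => forall m, B m -> `|box_avg (fun n => f (z + w n))
    m N| <= e) _.
have H : forall z0, [set: K] z0 -> \forall z \near z0 & N \near \oo, forall m,
    B m ->
    `|box_avg (fun n => f (z + w n)) m N| <= e.
  move=> z0 _.
  have h1 : \forall z \near z0, forall x, `|f ((z - z0) + x) - f x| <= e / 2.
    have : (fun z => z - z0) @ z0 --> z0 - z0.
      by apply: (@continuous_comp K (K * K)%type K (fun z => (z, z0))
        (fun z => z.1 - z.2));
        [apply: cvg_pair; [exact: cvg_id|exact: cvg_cst]|exact: sub_continuous].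
    by rewrite subrr => /(_ _ (uniformly_continuous_translate cK cf e20)).
  have cz : continuous (fun x => f (z0 + x)).
    by move=> x; apply: continuous_comp; [exact: continuous_addl|exact: cf].
  have h2 := ud_on_continuous cK udw cz e20.
  near=> z N => m Bm.
  have N0 : (0 < N)%N by near: N; exact: nbhs_infty_gt.
  have c1 : `|box_avg (fun n => f (z + w n)) m N - box_avg
      (fun n => f (z0 + w n)) m N| <= e / 2.
    apply: box_avg_close => // n.
    have : forall x, `|f ((z - z0) + x) - f x| <= e / 2 by near: z.
    by move=> /(_ (z0 + w n)); rewrite addrA subrK.
  have c2 : `|box_avg (fun n => f (z0 + w n)) m N| <= e / 2.
    have : forall m, B m -> `|box_avg (fun n => f (z0 + w n)) m N - \int[mu]_x f
        (z0 + x)| <= e / 2.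
      by near: N.
    by move=> /(_ _ Bm); rewrite Rintegral_translate// f0 subr0.
  rewrite -[box_avg _ _ _](subrK (box_avg (fun n => f (z0 + w n)) m N)).
  by rewrite (splitr e); apply: le_trans (ler_normD _ _) _; exact: lerD.
move=> /(_ _ H); apply: filterS => N HN z; exact: HN.
Unshelve. all: by end_near. Qed.

(** The autocorrelation of f: by translation invariance it gives the inner
    product in L^2(K) of any two translates of f. *)
Definition corr (w : K) := \int[mu]_z (f (z + w) * f z).

Lemma Rintegral_corr a b : \int[mu]_z (f (z + a) * f (z + b)) = corr (a - b).
Proof.
rewrite -(Rintegral_translate cK hmu (- b)) /=; last first.
  by move=> z; apply: cvgM; exact: continuous_comp_addr.
rewrite /corr; apply: eq_Rintegral => z _.
by rewrite -!addrA [- b + _]addrC [- b + _]addrC -!addrA subrr addr0.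
Qed.

Lemma corr_opp w : corr (- w) = corr w.
Proof.
rewrite -[w in LHS]subr0 opprB -Rintegral_corr; apply: eq_Rintegral => z _.
by rewrite addr0 mulrC.
Qed.

Lemma normr_corr_le (M : R) w : (forall x, `|f x| <= M) -> `|corr w| <= M ^+ 2.
Proof.
move=> fM; apply: (normr_Rintegral_le cK).
  by apply: continuous_integrable => // z; apply: cvgM;
    [exact: continuous_comp_addr|exact: cf].
by move=> z; rewrite normrM expr2 ler_pM.
Qed.

(** The integral over z and the finite average are exchanged, and the average of
    f(z + w n) is small uniformly in z. *)
Lemma corr_avg_small (w : vec d -> K) : ud_on mu B w -> forall e : R, 0 < e ->
  \forall N \near \oo, forall m, B m -> `|box_avg (fun n => corr (w n)) m N| <=
    e.
Proof.
move=> udw e e0; have [M M0 fM] := continuous_bounded cK cf.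
have eM : 0 < e / M by rewrite divr_gt0.
apply: filterS (ud_translates udw eM) => N HN m Bm.
have -> : box_avg (fun n => corr (w n)) m N =
    \int[mu]_z (box_avg (fun n => f (z + w n)) m N * f z).
  rewrite box_avgE /corr -(Rintegral_fsum cK); last first.
    by move=> i; apply: continuous_integrable => // z; apply: cvgM;
      [exact: continuous_comp_addr|exact: cf].
  rewrite mulrC -RintegralZl//; last first.
    apply: (integrable_fsum cK) => i.
    by apply: continuous_integrable => // z; apply: cvgM;
      [exact: continuous_comp_addr|exact: cf].
  apply: eq_Rintegral => z _; rewrite box_avgE mulr_suml mulr_sumr mulr_suml.
  by apply: eq_bigr => n _; rewrite mulrCA mulrA.
apply: (normr_Rintegral_le cK).
  apply: continuous_integrable => // z; apply: cvgM; last exact: cf.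
  move: z; rewrite -/(continuous _).
  have -> : (fun z => box_avg (fun n => f (z + w n)) m N) =
      (fun z => (\sum_(x <- rect m (m + diagv d N)) f (z + w x)) / N%:R ^+ d).
    by apply/funext => z; rewrite box_avgE.
  move=> z; apply: cvgM; last exact: cvg_cst.
  by apply: continuous_fsum => i; exact: continuous_comp_addr.
move=> z; rewrite normrM -[leRHS](divfK (lt0r_neq0 M0)).
by apply: ler_pM => //; exact: HN.
Qed.

Variable u : vec d -> K.
Hypothesis Hu : forall h, Npos h -> ud_on mu B (fun m => u (m + h) - u m).

(** For s < t the difference of u along (s, ..., s) and (t, ..., t) is, up to a
    translation of the box, the difference along the single shift
    (t - s, ..., t - s), whose coordinates are positive. *)
Lemma corr_avg_shift_small (s t : nat) : s != t -> forall e : R, 0 < e ->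
  \forall N \near \oo, forall m, B m ->
    `|box_avg (fun n => corr (u (n + diagv d t) - u (n + diagv d s))) m N| <= e.
Proof.
wlog st : s t / (s < t)%N => [hw st|].
  have [lt|lt|eq] := ltngtP s t; [exact: hw| |by rewrite eq eqxx in st].
  move=> e e0; have := hw t s lt _ e e0; rewrite eq_sym => /(_ st).
  apply: filterS => N HN m Bm; have := HN m Bm.
  suff -> : (fun n => corr (u (n + diagv d s) - u (n + diagv d t))) =
    (fun n => corr (u (n + diagv d t) - u (n + diagv d s))) by [].
  by apply/funext => n; rewrite -corr_opp opprB.
move=> _ e e0; have [M M0 fM] := continuous_bounded cK cf.
have e20 : 0 < e / 2 by rewrite divr_gt0.
have Nh : Npos (diagv d (t - s)) by move=> j; rewrite ffunE subn_gt0.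
pose G n := corr (u (n + diagv d (t - s)) - u n).
have H1 := corr_avg_small (Hu Nh) e20.
near=> N => m Bm.
have N0 : (0 < N)%N by near: N; exact: nbhs_infty_gt.
have h1 : `|box_avg G m N| <= e / 2 by move: m Bm; near: N.
have -> : box_avg (fun n => corr (u (n + diagv d t) - u (n + diagv d s))) m N =
   box_avg (fun n => G (n + diagv d s)) m N.
  suff -> : (fun n => corr (u (n + diagv d t) - u (n + diagv d s))) =
    (fun n => G (n + diagv d s)) by [].
  apply/funext => n; rewrite /G -addrA.
  suff -> : diagv d t = diagv d s + diagv d (t - s)
      by rewrite [diagv d s + _]addrC.
  by apply/ffunP => j; rewrite vecD !ffunE subnKC// ltnW.
have h2 : `|box_avg (fun n => G (n + diagv d s)) m N - box_avg G m N| <= e / 2.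
  apply: le_trans (@box_avg_shift _ _ hd G (M ^+ 2) _ _ _ N0 _) _.
    by move=> x; exact: normr_corr_le.
  rewrite ler_pdivrMr ?ltr0n// -ler_pdivrMl//.
  by near: N; exact: nbhs_infty_ger.
rewrite -[box_avg _ _ _](subrK (box_avg G m N)).
by rewrite (splitr e); apply: le_trans (ler_normD _ _) _; exact: lerD.
Unshelve. all: by end_near. Qed.

Variable theta : vec d -> R.
Hypothesis thetaD : forall n h, theta (n + h) = theta n + theta h.

(** The function z |-> f(z + u(n)) stands for the point n in L^2(K); the value
    at z = 0 is the sum of interest. *)
Definition wsum (c : vec d -> R) p q z :=
  \sum_(n <- rect p q) c n * f (z + u n).

Lemma wsum_continuous c p q : continuous (wsum c p q).
Proof.
apply: continuous_fsum => n z; apply: cvgM; first exact: cvg_cst.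
exact: continuous_comp_addr.
Qed.

(** The cosine and sine weights are treated together because
    cos a cos b + sin a sin b = cos (a - b): as theta is additive, the phase
    factors of the cross terms do not depend on n and leave the sum over n. *)
Lemma Rintegral_wsum_le (M : R) (L H : nat) (b p q : vec d) :
    (forall x, `|f x| <= M) ->
    (forall i, b i <= p i)%N -> (forall i, q i <= b i + L)%N ->
  H%:R ^+ 2 * \int[mu]_z (wsum (cos \o theta) p q z ^+ 2 + wsum (sin \o theta) p
    q z ^+ 2) <=
  4 * (2 * M * (H * (d * H * L ^ d.-1))%:R) ^+ 2 + 2 * (L ^ d)%:R *
   \sum_(s < H) \sum_(t < H) cos (theta (diagv d t) - theta (diagv d s)) *
      \sum_(n <- rect b (b + diagv d L)) corr
        (u (n + diagv d t) - u (n + diagv d s)).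
Proof.
move=> fM bp qb.
pose E : R := 2 * M * (H * (d * H * L ^ d.-1))%:R.
pose X (c : vec d -> R) z n := c n * f (z + u n).
pose F (s t : 'I_H) n z := cos (theta (diagv d t) - theta (diagv d s)) *
   (f (z + u (n + diagv d t)) * f (z + u (n + diagv d s))).
pose Q z : R := \sum_(s < H) \sum_(t < H) \sum_(n <- rect b (b + diagv d L)) F s
    t n z.
have pw z : H%:R ^+ 2 * (wsum (cos \o theta) p q z ^+ 2 + wsum (sin \o theta) p
    q z ^+ 2)
   <= 4 * E ^+ 2 + 2 * (L ^ d)%:R * Q z.
  have X1 : forall n, `|X (cos \o theta) z n| <= M.
    move=> n; rewrite normrM -[M]mul1r ler_pM// ler_norml.
    by rewrite cos_geN1 cos_le1.
  have X2 : forall n, `|X (sin \o theta) z n| <= M.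
    move=> n; rewrite normrM -[M]mul1r ler_pM// ler_norml.
    by rewrite sin_geN1 sin_le1.
  have := lerD (van_der_corput H X1 bp qb) (van_der_corput H X2 bp qb).
  rewrite -/E !exprMn -mulrDr => /le_trans; apply.
  rewrite addrACA -mulrDl -natrD lerD2l -mulrDr ler_wpM2l//.
  rewrite -big_split /= /Q le_eqVlt; apply/orP; left; apply/eqP.
  under [RHS]eq_bigr do rewrite exchange_big /=.
  rewrite [RHS]exchange_big /=; apply: eq_bigr => n _.
  rewrite !expr2 !mulr_suml -big_split /=; apply: eq_bigr => s _.
  rewrite !mulr_sumr -big_split /=; apply: eq_bigr => t _.
  rewrite /F.
  have -> : theta (diagv d t) - theta (diagv d s) =
      theta (n + diagv d t) - theta (n + diagv d s) by rewrite !thetaD; ring.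
  by rewrite cosB /X /=; ring.
have cF s t n : continuous (F s t n).
  move=> z; apply: cvgM; first exact: cvg_cst.
  by apply: cvgM; exact: continuous_comp_addr.
have cQ : continuous Q.
  by do 3 (apply: continuous_fsum => ?); exact: cF.
have intQ : \int[mu]_z Q z = \sum_(s < H) \sum_(t < H) cos
    (theta (diagv d t) - theta (diagv d s)) *
      \sum_(n <- rect b (b + diagv d L)) corr
        (u (n + diagv d t) - u (n + diagv d s)).
  rewrite (Rintegral_fsum cK); last first.
    by move=> s; apply: continuous_integrable => //;
      do 2 (apply: continuous_fsum => ?); exact: cF.
  apply: eq_bigr => s _; rewrite (Rintegral_fsum cK); last first.
    by move=> t; apply: continuous_integrable => //; apply: continuous_fsum =>
      ?; exact: cF.
  apply: eq_bigr => t _; rewrite (Rintegral_fsum cK); last first.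
    by move=> n; apply: continuous_integrable => //; exact: cF.
  rewrite mulr_sumr; apply: eq_bigr => n _.
  rewrite /F RintegralZl//; last first.
    by apply: continuous_integrable => // z; apply: cvgM;
      exact: continuous_comp_addr.
  by rewrite Rintegral_corr.
have cW : continuous (fun z => wsum (cos \o theta) p q z ^+ 2 +
    wsum (sin \o theta) p q z ^+ 2).
  by move=> z; apply: cvgD; apply: cvgM; exact: wsum_continuous.
have cDQ : continuous (fun z => 2 * (L ^ d)%:R * Q z).
  by move=> z; apply: cvgM; [exact: cvg_cst|exact: cQ].
have intR : \int[mu]_z (4 * E ^+ 2 + 2 * (L ^ d)%:R * Q z) =
    4 * E ^+ 2 + 2 * (L ^ d)%:R * \int[mu]_z Q z.
  rewrite RintegralD//; last exact: continuous_integrable.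
    by rewrite Rintegral_const RintegralZl//; exact: continuous_integrable.
  by apply: continuous_integrable => // z; exact: cvg_cst.
have intL : \int[mu]_z (H%:R ^+
    2 * (wsum (cos \o theta) p q z ^+ 2 + wsum (sin \o theta) p q z ^+ 2)) =
   H%:R ^+ 2 * \int[mu]_z (wsum (cos \o theta) p q z ^+ 2 + wsum (sin \o theta)
     p q z ^+ 2).
  by rewrite RintegralZl//; exact: continuous_integrable.
rewrite -intQ -/E -intR -intL.
apply: le_Rintegral_continuous => //.
- by move=> z; apply: cvgM; [exact: cvg_cst|exact: cW].
- by move=> z; apply: cvgD; [exact: cvg_cst|exact: cDQ].
Qed.

(** The H diagonal terms contribute 2 M^2 / H, the other ones tend to 0 by
    [corr_avg_shift_small] and the boundary term is C / L^2: each is made at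
    most e / 3, choosing first H and then L. *)
Lemma wsum_L2_small (e : R) : 0 < e -> \forall L \near \oo, forall b p q :
    vec d, B b ->
    (forall i, b i <= p i)%N -> (forall i, q i <= b i + L)%N ->
  \int[mu]_z (wsum (cos \o theta) p q z ^+ 2 + wsum (sin \o theta) p q z ^+ 2)
    <=
    e * (L ^ d)%:R ^+ 2.
Proof.
move=> e0; have [M M0 fM] := continuous_bounded cK cf.
have [H H0 HM] : exists2 H : nat, (0 < H)%N & 2 * M ^+ 2 / H%:R <= e / 3.
  exists (Num.truncn (6 * M ^+ 2 / e)).+1 => //.
  rewrite ler_pdivrMr ?ltr0n//.
  have := truncnS_gt (6 * M ^+ 2 / e); rewrite ltr_pdivrMr// => /ltW.
  by rewrite mulrC; lra.
have e60 : 0 < e / 6 by rewrite divr_gt0.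
pose G (s t : nat) b N :=
    box_avg (fun n => corr (u (n + diagv d t) - u (n + diagv d s))) b N.
have HG : \forall L \near \oo, forall s t : 'I_H, s != t -> forall b, B b ->
    `|G s t b L| <= e / 6.
  apply: filter_forall => s; apply: filter_forall => t.
  have [->|st] := eqVneq s t; first by apply: nearW.
  by apply: filterS (corr_avg_shift_small st e60) => L HL _.
(* C / L^2 is the square of the boundary term, after division by H^2 L^(2d). *)
pose C : R := 16 * M ^+ 2 * d%:R ^+ 2 * H%:R ^+ 2.
near=> L => b p q Bb bp qb.
have L0 : (0 < L)%N by near: L; exact: nbhs_infty_gt.
have HGL : forall s t : 'I_H, s != t -> forall b, B b -> `|G s t b L| <= e / 6
    by near: L.
have LC : (e / 3)^-1 * C <= L%:R by near: L; exact: nbhs_infty_ger.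
have H2 : 0 < H%:R ^+ 2 :> R by rewrite exprn_gt0// ltr0n.
rewrite -(ler_pM2l H2); apply: le_trans (Rintegral_wsum_le H fM bp qb) _.
set D : R := (L ^ d)%:R.
have D0 : 0 < D by rewrite ltr0n expn_gt0 L0.
have sumE s t : \sum_(n <- rect b (b + diagv d L)) corr
    (u (n + diagv d t) - u (n + diagv d s)) =
    D * G s t b L.
  by rewrite /G box_avgE -natrX -/D mulrC divfK// gt_eqF.
have termle (s t : 'I_H) : cos (theta (diagv d t) - theta (diagv d s)) *
   \sum_(n <- rect b (b + diagv d L)) corr
     (u (n + diagv d t) - u (n + diagv d s)) <=
   D * (e / 6) + (if t == s then D * M ^+ 2 else 0).
  rewrite sumE mulrCA; have [->|st] := eqVneq t s.
    rewrite -mulrDr ler_pM2l// subrr cos0 mul1r -[leLHS]add0r lerD ?(ltW e60)//.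
    apply: le_trans (ler_norm _) _.
    rewrite -[G _ _ _ _]subr0 -(box_avg_const (0 : R) b L0);
      apply: box_avg_close => // n.
    by rewrite subr0; exact: normr_corr_le.
  rewrite addr0 ler_pM2l//; apply: le_trans (ler_norm _) _; rewrite normrM.
  rewrite -[leRHS]mul1r; apply: ler_pM => //; last by apply: HGL => //;
    rewrite eq_sym.
  by rewrite ler_norml cos_geN1 cos_le1.
apply: (@le_trans _ _ (4 * (2 * M * (H * (d * H * L ^ d.-1))%:R) ^+ 2 +
   2 * D * (H%:R ^+ 2 * (D * (e / 6)) + H%:R * (D * M ^+ 2)))).
  rewrite lerD2l ler_wpM2l ?mulr_ge0 ?(ltW D0)//.
  apply: (@le_trans _ _ (\sum_(s < H) \sum_(t < H)
    (D * (e / 6) + (if t == s then D * M ^+ 2 else 0)))).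
    by apply: ler_sum => s _; apply: ler_sum => t _; exact: termle.
  rewrite le_eqVlt; apply/orP; left; apply/eqP.
  under eq_bigr do rewrite big_split /= sumr_const card_ord -big_mkcond
    big_pred1_eq.
  by rewrite sumr_const card_ord -(mulr_natl (_ + _))
    -(mulr_natl (D * (e / 6))); ring.
have L1 : 0 < L%:R :> R by rewrite ltr0n.
have H1 : 0 < H%:R :> R by rewrite ltr0n.
have DE : (L ^ d.-1)%:R = D / L%:R :> R.
  rewrite /D; have -> : (L ^ d = L ^ d.-1 * L)%N by rewrite -expnSr prednK.
  by rewrite natrM mulfK// gt_eqF.
have -> : (H * (d * H * L ^ d.-1))%:R = H%:R * (d%:R * H%:R * (D / L%:R)) :> R.
  by rewrite !natrM DE.
have xle : C / L%:R ^+ 2 <= e / 3.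
  rewrite ler_pdivrMr ?exprn_gt0//.
  move: LC; rewrite ler_pdivrMl ?divr_gt0// => /le_trans; apply.
  rewrite ler_pM2l ?divr_gt0// expr2 ler_peMr ?(ltW L1)//.
  by rewrite ler1n.
have -> : 4 * (2 * M * (H%:R * (d%:R * H%:R * (D / L%:R)))) ^+ 2 +
   2 * D * (H%:R ^+ 2 * (D * (e / 6)) + H%:R * (D * M ^+ 2)) =
   H%:R ^+ 2 * D ^+ 2 * (C / L%:R ^+ 2 + e / 3 + 2 * M ^+ 2 / H%:R).
  by rewrite /C; field; rewrite !gt_eqF.
rewrite -mulrA ler_pM2l// [leLHS]mulrC ler_pM2r ?exprn_gt0//.
by move: xle HM; move: (C / _) (2 * M ^+ 2 / _) => x y; lra.
Unshelve. all: by end_near. Qed.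

(** Rectangles occur here because n maps boxes to rectangles; the error is
    measured by the surrounding box, whose base point lies in B. *)
Definition null_weight (c : vec d -> R) := forall e : R, 0 < e ->
  \forall L \near \oo, forall b p q : vec d, B b ->
    (forall i, b i <= p i)%N -> (forall i, q i <= b i + L)%N ->
  `|\sum_(n <- rect p q) c n * f (u n)| <= e * (L ^ d)%:R.

(** Equicontinuity: the normalized sum moves by at most e / 2 wherever all
    translates of f do, since |c| <= 1 and the rectangle has at most L^d
    points. *)
Lemma null_weight_of_L2 (c : vec d -> R) : (forall n, `|c n| <= 1) ->
  (forall e : R, 0 < e -> \forall L \near \oo, forall b p q : vec d, B b ->
    (forall i, b i <= p i)%N -> (forall i, q i <= b i + L)%N ->
    \int[mu]_z (wsum c p q z ^+ 2) <= e * (L ^ d)%:R ^+ 2) ->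
  null_weight c.
Proof.
move=> c1 H e e0; have [r r0 Hr] := small_L2_small_at0 cK hmu cf e0.
near=> L => b p q Bb bp qb.
have L0 : (0 < L)%N by near: L; exact: nbhs_infty_gt.
set D : R := (L ^ d)%:R.
have D0 : 0 < D by rewrite ltr0n expn_gt0 L0.
have HL : forall b p q : vec d, B b ->
    (forall i, b i <= p i)%N -> (forall i, q i <= b i + L)%N ->
    \int[mu]_z (wsum c p q z ^+ 2) <= r * (L ^ d)%:R ^+ 2 by near: L; exact: H.
pose S z := D^-1 * wsum c p q z.
have cS : continuous S by move=> z; apply: cvgM;
    [exact: cvg_cst|exact: wsum_continuous].
have -> : \sum_(n <- rect p q) c n * f (u n) = D * S 0.
  by rewrite /S mulVKf ?gt_eqF// /wsum; apply: eq_bigr => n _; rewrite add0r.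
rewrite normrM gtr0_norm// mulrC ler_pM2r//; apply: Hr => //.
  move=> v Hv; rewrite /S -mulrBr normrM gtr0_norm ?invr_gt0// ler_pdivrMl//.
  rewrite /wsum -sumrB.
  have h : forall n, `|c n * f (v + u n) - c n * f (0 + u n)| <= e / 2.
    move=> n; rewrite add0r -mulrBr normrM -[leRHS]mul1r; exact: ler_pM.
  apply: le_trans (normr_sum_fset _ h) _; rewrite ler_pM2r ?divr_gt0//.
  rewrite ler_nat -(card_box b); apply: card_fset_le; apply/fsubsetP.
  exact: rect_sub_box.
rewrite /S; under eq_Rintegral do rewrite exprMn.
rewrite RintegralZl//; last first.
  by apply: continuous_integrable => // z; apply: cvgM; exact: wsum_continuous.
by rewrite exprVn ler_pdivrMl ?exprn_gt0// [leRHS]mulrC; exact: (HL b).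
Unshelve. all: by end_near. Qed.

Lemma null_weight_trig : null_weight (cos \o theta) /\ null_weight
    (sin \o theta).
Proof.
split; apply: null_weight_of_L2 => [n|e e0].
- by rewrite ler_norml cos_geN1 cos_le1.
- apply: filterS (wsum_L2_small e0) => L HL b p q Bb bp qb;
    apply: le_trans (HL b p q Bb bp qb).
  apply: le_Rintegral_continuous => //;
    try (by move=> z; apply: cvgM; exact: wsum_continuous).
    by move=> z; apply: cvgD; apply: cvgM; exact: wsum_continuous.
  by move=> z; rewrite lerDl sqr_ge0.
- by rewrite ler_norml sin_geN1 sin_le1.
- apply: filterS (wsum_L2_small e0) => L HL b p q Bb bp qb;
    apply: le_trans (HL b p q Bb bp qb).
  apply: le_Rintegral_continuous => //;
    try (by move=> z; apply: cvgM; exact: wsum_continuous).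
    by move=> z; apply: cvgD; apply: cvgM; exact: wsum_continuous.
  by move=> z; rewrite lerDr sqr_ge0.
Qed.

Lemma null_weightD c1 c2 : null_weight c1 -> null_weight c2 ->
  null_weight (fun n => c1 n + c2 n).
Proof.
move=> H1 H2 e e0; have e20 : 0 < e / 2 by rewrite divr_gt0.
apply: filterS2 (H1 _ e20) (H2 _ e20) => L h1 h2 b p q Bb bp qb.
under eq_bigr do rewrite mulrDl.
rewrite big_split /= (splitr e) mulrDl; apply: le_trans (ler_normD _ _) _.
by apply: lerD; [exact: (h1 b) | exact: (h2 b)].
Qed.

Lemma null_weightZ (a : R) c : null_weight c -> null_weight (fun n => a * c n).
Proof.
move=> H e e0; have a0 : 0 < `|a| + 1 by rewrite ltr_wpDl.
have ea0 : 0 < e / (`|a| + 1) by rewrite divr_gt0.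
apply: filterS (H _ ea0) => L h b p q Bb bp qb.
under eq_bigr do rewrite -mulrA.
rewrite -mulr_sumr normrM.
apply: (@le_trans _ _ ((`|a| + 1) * (e / (`|a| + 1) * (L ^ d)%:R))).
  by apply: ler_pM => //; [rewrite lerDl|exact: (h b)].
by rewrite mulrA mulrCA mulfV ?mulr1// gt_eqF.
Qed.

Lemma null_weight_sum (I : Type) (r : seq I) (c : I -> vec d -> R) :
  (forall i, null_weight (c i)) -> null_weight (fun n => \sum_(i <- r) c i n).
Proof.
move=> H; elim: r => [|i r IH].
  move=> e e0; apply: nearW => L b p q _ _ _.
  under eq_bigr do rewrite big_nil mul0r.
  by rewrite big1 ?normr0 ?mulr_ge0// ltW.
have -> : (fun n => \sum_(i <- i :: r) c i n) =
    (fun n => c i n + \sum_(i <- r) c i n).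
  by apply/funext => n; rewrite big_cons.
exact: null_weightD.
Qed.

(** The error |c - P| is nonnegative, so its sum over the rectangle is at most
    its sum over the box. *)
Lemma null_weight_approx (c : vec d -> R) :
  (forall e : R, 0 < e -> exists2 P, null_weight P &
    \forall L \near \oo, forall b, B b -> box_avg (fun n => `|c n - P n|) b L <=
      e) ->
  null_weight c.
Proof.
move=> H e e0; have [M M0 fM] := continuous_bounded cK cf.
have e20 : 0 < e / 2 by rewrite divr_gt0.
have [P nP HP] := H _ (divr_gt0 e20 M0).
near=> L => b p q Bb bp qb.
have L0 : (0 < L)%N by near: L; exact: nbhs_infty_gt.
have h1 : `|\sum_(n <- rect p q) P n * f (u n)| <= e / 2 * (L ^ d)%:R.
  by move: b p q Bb bp qb; near: L; exact: nP.
have h2 : box_avg (fun n => `|c n - P n|) b L <= e / 2 / M.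
  by move: {h1} b Bb {bp qb}; near: L.
have D0 : 0 < (L ^ d)%:R :> R by rewrite ltr0n expn_gt0 L0.
have -> : \sum_(n <- rect p q) c n * f (u n) =
   \sum_(n <- rect p q) P n * f (u n) + \sum_(n <- rect p q) (c n - P n) * f
     (u n).
  by rewrite -big_split /=; apply: eq_bigr => n _; rewrite -mulrDl subrKC.
rewrite (splitr e) mulrDl; apply: le_trans (ler_normD _ _) _; apply: lerD => //.
apply: le_trans (ler_norm_sum _ _ _) _.
apply: (@le_trans _ _ (M * \sum_(n <- rect b (b + diagv d L)) `|c n - P n|)).
  rewrite mulr_sumr; apply: le_trans (sum_fset_le (rect_sub_box bp qb) _).
    by apply: ler_sum => n _; rewrite normrM mulrC ler_pM.
  by move=> n; rewrite mulr_ge0// ltW.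
move: h2; rewrite box_avgE -natrX ler_pdivrMr// => h2.
by rewrite -ler_pdivlMl// mulrA [M^-1 * _]mulrC.
Unshelve. all: by end_near. Qed.

End vdc_main.

(** * Sequences increasing in each coordinate *)

Section subsequence.
Context {R : realType} {d : nat}.
Variable n : vec d -> vec d.
Hypothesis nP : {homo n : a / Npos a}.
Hypothesis nI : increasing_vec n.

(** The j-th coordinate of n(a) depends on a_j only.  The value 0 at 0 turns the
    boxes based at 0 and at a point of N^d into one case. *)
Definition nu1 (j : 'I_d) (t : nat) : nat :=
  if t == 0%N then 0%N else n (diagv d t) j.
Definition nu (a : vec d) : vec d := [ffun j => nu1 j (a j)].

Lemma Npos_diagv t : (0 < t)%N -> Npos (diagv d t).
Proof. by move=> t0 j; rewrite ffunE. Qed.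

Lemma nu1_lt j s t : (s < t)%N -> (nu1 j s < nu1 j t)%N.
Proof.
move=> st; have t0 : (0 < t)%N by exact: leq_ltn_trans st.
rewrite /nu1 (gtn_eqF t0); case: eqP => [_|/eqP];
  first exact: nP (Npos_diagv t0) j.
rewrite -lt0n => s0; have [_] := nI (Npos_diagv s0) (Npos_diagv t0) j.
by rewrite !ffunE; apply.
Qed.

Lemma nu1_mono j : {mono nu1 j : s t / (s <= t)%N}.
Proof. exact: leq_mono (nu1_lt j). Qed.

Lemma nu1_gap j s t : (nu1 j s + t <= nu1 j (s + t))%N.
Proof.
elim: t => [|t IH]; first by rewrite !addn0.
by rewrite !addnS; apply: leq_ltn_trans IH _; exact: nu1_lt.
Qed.

Lemma nuE a : Npos a -> n a = nu a.
Proof.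
move=> a0; apply/ffunP => j; rewrite ffunE /nu1 gtn_eqF ?a0//.
apply/eqP; rewrite eqn_leq; apply/andP; split.
  by have [+ _] := nI a0 (Npos_diagv (a0 j)) j; rewrite ffunE; apply.
by have [+ _] := nI (Npos_diagv (a0 j)) a0 j; rewrite ffunE; apply.
Qed.

Lemma nu_inj : injective nu.
Proof.
move=> a b /ffunP ab; apply/ffunP => j; have := ab j; rewrite !ffunE.
by apply: incn_inj => s t; exact: nu1_mono.
Qed.

Let A := n @` @Npos d.

(** As n is strictly increasing in each coordinate, k lies in the box exactly
    when n(k) lies in the rectangle. *)
Lemma sum_subsequence (g : vec d -> R) m N :
  \sum_(k <- rect m (m + diagv d N)) g (n k) =
  \sum_(x <- rect (nu m) (nu (m + diagv d N))) \1_A x * g x.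
Proof.
set X := rect m _; set Y := rect (nu m) _.
have pos k : k \in X -> Npos k.
  by move=> /rectP kX j; have := kX j; lia.
have E : [fset nu k | k in X]%fset = [fset x in Y | x \in A]%fset.
  apply/fsetP => x; apply/imfsetP/idP => /=.
    move=> [k kX ->]; rewrite !inE /=; apply/andP; split; last first.
      by rewrite inE; exists k; [exact: pos|exact/nuE/pos].
    move/rectP: kX => kX; apply/rectP => j; rewrite !ffunE.
    by have /andP[h1 h2] := kX j; rewrite nu1_lt//= nu1_mono; move: h2;
      rewrite !ffunE.
  rewrite !inE /= => /andP[/rectP xY]; rewrite inE => -[a a0 ax].
  exists a; last by rewrite -ax nuE.
  apply/rectP => j; have := xY j; rewrite -ax nuE// !ffunE !nu1_mono.
  by rewrite (leqW_mono (@nu1_mono j)).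
transitivity (\sum_(x <- [fset nu k | k in X]%fset) g x).
  rewrite [RHS]big_imfset /=; last by move=> a b _ _; exact: nu_inj.
  by apply: eq_fbigr => k kX _; rewrite nuE//; exact: pos.
rewrite E big_fset big_mkcond /=; apply: eq_bigr => x _.
by rewrite indicE; case: ifP; rewrite ?mul1r ?mul0r.
Qed.

Variable B : set (vec d).
Hypothesis Bnu : forall m, B m -> B (nu m).

(** If the j-th side of the rectangle from nu m to nu (m + N) were longer than
    L = C N, the box of side L at nu m would meet the range of n in at most
    N L^(d-1) points: fewer than N choices in the j-th coordinate and at most L
    in the others.  For C > 1 / delta this contradicts density delta. *)
Lemma nu_growth (hd : (0 < d)%N) (delta : R) : 0 < delta ->
  (\forall L \near \oo, forall b, B b -> delta <= box_freq R A b L) ->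
  exists2 C : nat, (0 < C)%N & \forall N \near \oo, forall m, B m ->
    forall j, (nu1 j (m j + N) <= nu1 j (m j) + C * N)%N.
Proof.
move=> d0 [L0 _ HL]; pose C := (Num.truncn delta^-1).+1.
have Cd : 1 < delta * C%:R.
  by rewrite -ltr_pdivrMl// mulr1 /C truncnS_gt.
exists C => //; near=> N => m Bm j.
have N0 : (0 < N)%N by near: N; exact: nbhs_infty_gt.
have NL : (L0 <= N)%N by near: N; exact: nbhs_infty_ge.
rewrite leqNgt; apply/negP => big.
have LL : (L0 <= C * N)%N by apply: leq_trans NL _; rewrite leq_pmull.
have := HL _ LL _ (Bnu Bm); set L := (C * N)%N in big LL *.
have L1 : 0 < L%:R :> R by rewrite ltr0n /L muln_gt0.
pose S := [fset a in rect m (m + diagv d L)%R | (a j <= m j + N)%N]%fset.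
have cS : (#|` fset_set (A `&` box (nu m) L)| <= #|` S|)%N.
  apply: (@leq_trans #|` [fset nu a | a in S]%fset|);
    last exact: leq_imfset_card.
  apply: card_fset_le => x; rewrite in_fset_set; last first.
    by rewrite boxE; apply: finite_setIr; exact: finite_fset.
  rewrite inE => -[[a a0 <-] ax]; apply/imfsetP; exists a; last by rewrite nuE.
  rewrite !inE /=; move: ax; rewrite nuE// => ax; apply/andP; split.
    apply/rectP => i; have := ax i; rewrite !(vecD, ffunE) => /andP[h1 h2].
    rewrite -(leqW_mono (@nu1_mono i)) h1 /= leqNgt; apply/negP => lt.
    have := nu1_gap i (m i) L; have := nu1_lt i lt; lia.
  have := ax j; rewrite !ffunE => /andP[_ h2].
  rewrite -(nu1_mono j); lia.
have {}cS : (#|` fset_set (A `&` box (nu m) L)| <= N * L ^ d.-1)%N.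
  by apply: leq_trans cS _; apply: card_rect_slab => i;
    rewrite vecD ffunE addnC addnK.
rewrite /box_freq ler_pdivlMr ?exprn_gt0// => h.
have : delta * L%:R ^+ d <= (N * L ^ d.-1)%:R by apply: le_trans h _;
    rewrite ler_nat.
have -> : L%:R ^+ d = L%:R * L%:R ^+ d.-1 :> R by rewrite -exprS prednK.
rewrite natrM natrX mulrA ler_pM2r ?exprn_gt0// /L natrM mulrA => h2.
have : N%:R < delta * C%:R * N%:R :> R by rewrite ltr_pMl// ltr0n.
by rewrite ltNge h2.
Unshelve. all: by end_near. Qed.
End subsequence.

Section equidistribution.
Context {R : realType} {K : topologicalZmodType}.
Hypothesis cK : compact [set: K].
Hypothesis hK : hausdorff_space K.
Variable mu : probability [the measurableType _ of borel K] R.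
Hypothesis hmu : is_haar mu.
Context {d : nat}.
Hypothesis hd : (0 < d)%N.
Variable n : vec d -> vec d.
Hypothesis nP : {homo n : a / Npos a}.
Hypothesis nI : increasing_vec n.
Variable B : set (vec d).
Hypothesis Bnu : forall m, B m -> B (nu n m).
Let A := n @` @Npos d.

(** The box of side N is carried into a box of side L = C N, so an error
    e / C^d * L^d becomes e after division by N^d. *)
Lemma ud_on_subsequence (u : vec d -> K) (delta : R) : 0 < delta ->
  (\forall L \near \oo, forall b, B b -> delta <= box_freq R A b L) ->
  (forall f : K -> R, continuous f -> \int[mu]_x f x = 0 ->
    null_weight B f u (\1_A)) ->
  ud_on mu B (fun k => u (n k)).
Proof.
move=> delta0 Hd Hnull; apply: ud_on_of_continuous => // f cf e e0.
have [C C0 HC] := nu_growth nP nI Bnu hd delta0 Hd.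
pose c := \int[mu]_x f x.
have cfc : continuous (fun x => f x - c) by move=> x; apply: cvgB;
    [exact: cf|exact: cvg_cst].
have fc0 : \int[mu]_x (f x - c) = 0.
  rewrite RintegralB//; last 2 first.
  - exact: continuous_integrable.
  - by apply: continuous_integrable => // x; exact: cvg_cst.
  by rewrite Rintegral_const subrr.
have eC : 0 < e / (C ^ d)%:R by rewrite divr_gt0// ltr0n expn_gt0 C0.
have [L0 _ HL] := Hnull _ cfc fc0 _ eC.
near=> N => m Bm.
have N0 : (0 < N)%N by near: N; exact: nbhs_infty_gt.
have NL : (L0 <= N)%N by near: N; exact: nbhs_infty_ge.
have growth : forall m, B m ->
    forall j, (nu1 n j (m j + N) <= nu1 n j (m j) + C * N)%N.
  by near: N.
rewrite -/c -{1}(box_avg_const c m N0) -box_avgB.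
rewrite box_avgE (sum_subsequence nP nI (fun x => f (u x) - c)).
rewrite normrM normfV normrX normr_nat ler_pdivrMr ?exprn_gt0 ?ltr0n//.
have CN : (L0 <= C * N)%N by apply: leq_trans NL _; rewrite leq_pmull.
have := HL _ CN (nu n m) (nu n m) (nu n (m + diagv d N)) (Bnu Bm).
move=> /(_ (fun=> leqnn _)) h.
have {}h : `|\sum_(x <- rect (nu n m) (nu n (m + diagv d N))) \1_A x *
    (f (u x) - c)| <=
   e / (C ^ d)%:R * ((C * N) ^ d)%:R.
  by apply: h => j; have := growth m Bm j; rewrite !(vecD, ffunE).
apply: le_trans h _; rewrite expnMn natrM mulrA divfK ?natrX//.
by rewrite gt_eqF// exprn_gt0// ltr0n.
Unshelve. all: by end_near. Qed.
End equidistribution.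

(** * Trigonometric polynomials *)

Section trig.
Context {R : realType} {d : nat}.
Implicit Types (al : {ffun 'I_d -> R}) (n h : vec d).

Definition phase al n : R := 2 * pi * \sum_(i < d) al i * (n i)%:R.

Lemma phaseD al n h : phase al (n + h) = phase al n + phase al h.
Proof.
rewrite /phase -mulrDr -big_split /=; congr (_ * _); apply: eq_bigr => i _.
by rewrite vecD natrD mulrDr.
Qed.

Lemma normr_Re_le (z : R[i]) : `|complex.Re z| <= Normc.normc z.
Proof.
by case: z => a b /=; rewrite -sqrtr_sqr ler_wsqrtr// lerDl sqr_ge0.
Qed.

(** Since the approximated function 1_A is real, passing to the real part of a
    trigonometric polynomial can only improve the approximation. *)
Definition re_trig l (alpha : 'I_l -> {ffun 'I_d -> R}) (c : 'I_l -> R[i]) n :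
  R :=
  \sum_(j < l) (complex.Re (c j) * cos (phase (alpha j) n) +
                - complex.Im (c j) * sin (phase (alpha j) n)).

Lemma Re_trig_poly l (alpha : 'I_l -> {ffun 'I_d -> R}) (c : 'I_l -> R[i]) n :
  complex.Re (trig_poly alpha c n) = re_trig alpha c n.
Proof.
rewrite /trig_poly /re_trig.
rewrite (big_morph (@complex.Re R) (id1 := 0) (op1 := +%R))//;
  last by move=> [a b] [a' b'].
by apply: eq_bigr => j _; rewrite /=; case: (c j) => a b /=; rewrite mulNr.
Qed.

Lemma re_trig_close l (alpha : 'I_l -> {ffun 'I_d -> R}) (c : 'I_l -> R[i])
    (A : set (vec d)) n :
  `|\1_A n - re_trig alpha c n| <= trig_dist (\1_A : vec d -> R[i]) alpha c n.
Proof.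
rewrite -Re_trig_poly /trig_dist; apply: le_trans (normr_Re_le _).
rewrite !indicE; case: (n \in A) => /=; case: (trig_poly _ _ _) => a b //=.
Qed.

Definition has_mean (g : vec d -> R) := exists l : R, box_avg g 0 N @[N --> \oo]
  --> l.

Lemma has_meanD g1 g2 : has_mean g1 -> has_mean g2 ->
    has_mean (fun x => g1 x + g2 x).
Proof.
move=> [l1 H1] [l2 H2]; exists (l1 + l2).
by under eq_fun do rewrite box_avgD; exact: cvgD.
Qed.

Lemma has_meanZ a g : has_mean g -> has_mean (fun x => a * g x).
Proof.
move=> [l H]; exists (a * l).
by under eq_fun do rewrite box_avgZ; apply: cvgM => //; exact: cvg_cst.
Qed.

Lemma has_mean_cst (c : R) : has_mean (fun=> c).
Proof.
exists c; apply/cvgrPdist_le => e e0; near=> N.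
rewrite box_avg_const ?subrr ?normr0 ?ltW//.
by near: N; exact: nbhs_infty_gt.
Unshelve. all: by end_near. Qed.

Lemma has_mean_sum (I : Type) (r : seq I) (g : I -> vec d -> R) :
  (forall i, has_mean (g i)) -> has_mean (fun x => \sum_(i <- r) g i x).
Proof.
move=> H; elim: r => [|i r IH].
  by under eq_fun do rewrite big_nil; exact: has_mean_cst.
by under eq_fun do rewrite big_cons; exact: has_meanD.
Qed.

(** The x with cos x = 1, hence sin x = 0, form a group. *)
Lemma phase_const al n : (forall i, cos (2 * pi * al i) = 1) ->
  cos (phase al n) = 1 /\ sin (phase al n) = 0.
Proof.
move=> H; rewrite /phase mulr_sumr.
pose G (x : R) := cos x = 1 /\ sin x = 0.
have G0 : G 0 by split; [exact: cos0|exact: sin0].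
have GD x y : G x -> G y -> G (x + y).
  by move=> [cx sx] [cy sy]; split; rewrite ?cosD ?sinD cx sx cy sy; ring.
apply: (big_ind G) => // i _; rewrite mulrA.
have Gi : G (2 * pi * al i).
  split; first exact: H.
  have := cos2Dsin2 (2 * pi * al i); rewrite H expr1n => /eqP.
  by rewrite -subr_eq0 addrAC subrr add0r sqrf_eq0 => /eqP.
elim: (n i) => [|k IH]; first by rewrite mulr0.
by rewrite -[k.+1%:R]natr1 mulrDr mulr1; exact: GD.
Qed.

(** If cos b <> 1 for the increment b of the phase along some axis, translating
    the box by one step along this axis rotates the pair of means by the angle b
    and moves it by at most 2 / N.  A rotation by b fixes only 0, so both means
    tend to 0. *)
Lemma has_mean_phase (hd : (0 < d)%N) al : has_mean (cos \o phase al) /\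
    has_mean (sin \o phase al).
Proof.
have [triv|] := pselect (forall i, cos (2 * pi * al i) = 1).
  split.
    have -> : cos \o phase al = (fun=> 1) by apply/funext => n /=;
        case: (phase_const n triv).
    exact: has_mean_cst.
  have -> : sin \o phase al = (fun=> 0) by apply/funext => n /=;
      case: (phase_const n triv).
  exact: has_mean_cst.
move=> /existsNP[i /eqP ci].
pose b := 2 * pi * al i.
pose h : vec d := [ffun k => (k == i : nat)].
have hE : phase al h = b.
  rewrite /phase (bigD1 i)//= big1 ?addr0 ?ffunE ?eqxx ?mulr1 // => k ki.
  by rewrite ffunE (negbTE ki) mulr0.
have sh : (\sum_j h j)%N = 1%N.
  rewrite (bigD1 i)//= big1 ?addn0 ?ffunE ?eqxx // => k ki.
  by rewrite ffunE (negbTE ki).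
pose Cn N := box_avg (cos \o phase al) 0 N.
pose Sn N := box_avg (sin \o phase al) 0 N.
have E1 N : (0 < N)%N -> `|cos b * Cn N - sin b * Sn N - Cn N| <= 2 / N%:R.
  move=> N0; have := @box_avg_shift _ _ hd (cos \o phase al) 1 0 N h N0.
  rewrite sh !mulr1.
  have -> : (fun x => (cos \o phase al) (x + h)) =
     (fun x => cos b * (cos \o phase al) x - sin b * (sin \o phase al) x).
    by apply/funext => x /=; rewrite phaseD hE cosD; ring.
  by rewrite box_avgB !box_avgZ; apply => x; rewrite ler_norml cos_geN1 cos_le1.
have E2 N : (0 < N)%N -> `|sin b * Cn N + cos b * Sn N - Sn N| <= 2 / N%:R.
  move=> N0; have := @box_avg_shift _ _ hd (sin \o phase al) 1 0 N h N0.
  rewrite sh !mulr1.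
  have -> : (fun x => (sin \o phase al) (x + h)) =
     (fun x => sin b * (cos \o phase al) x + cos b * (sin \o phase al) x).
    by apply/funext => x /=; rewrite phaseD hE sinD; ring.
  by rewrite box_avgD !box_avgZ; apply => x; rewrite ler_norml sin_geN1 sin_le1.
have c1 : `|cos b| <= 1 by rewrite ler_norml cos_geN1 cos_le1.
have s1 : `|sin b| <= 1 by rewrite ler_norml sin_geN1 sin_le1.
(* The determinant of (rotation by b) - identity. *)
pose rho : R := 2 - 2 * cos b.
have rho0 : 0 < rho by rewrite /rho; have := cos_le1 b;
    rewrite le_eqVlt (negbTE ci)/=; lra.
have bound (x y E F : R) : `|x| <= 1 -> `|y| <= 1 -> `|(x - 1) * E + y * F| <=
    2 * `|E| + `|F|.
  move=> x1 y1; apply: le_trans (ler_normD _ _) _; rewrite !normrM; apply: lerD.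
    by rewrite ler_wpM2r//; apply: le_trans (ler_normB _ _) _; rewrite normr1;
      lra.
  by rewrite -[leRHS]mul1r ler_wpM2r.
have key N : (0 < N)%N -> `|Cn N| <= rho^-1 * (6 / N%:R) /\ `|Sn N| <=
    rho^-1 * (6 / N%:R).
  move=> N0; have e1 := E1 N N0; have e2 := E2 N N0.
  have q : 6 / N%:R = 2 * (2 / N%:R) + 2 / N%:R :> R by ring.
  have cs := cos2Dsin2 b.
  split; rewrite ler_pdivlMl// -{1}(gtr0_norm rho0) -normrM.
    have -> : rho * Cn N = (cos b - 1) * (cos b * Cn N - sin b * Sn N - Cn N) +
        sin b * (sin b * Cn N + cos b * Sn N - Sn N).
      transitivity ((cos b ^+ 2 + sin b ^+ 2 + 1 - 2 * cos b) * Cn N);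
        last by ring.
      by rewrite cs /rho; ring.
    by apply: le_trans (bound _ _ _ _ c1 s1) _; lra.
  have -> : rho * Sn N = (cos b - 1) * (sin b * Cn N + cos b * Sn N - Sn N) +
      (- sin b) * (cos b * Cn N - sin b * Sn N - Cn N).
    transitivity ((cos b ^+ 2 + sin b ^+ 2 + 1 - 2 * cos b) * Sn N);
      last by ring.
    by rewrite cs /rho; ring.
  by apply: le_trans (bound _ _ _ _ c1 _) _; rewrite ?normrN//; lra.
have small e : 0 < e -> \forall N \near \oo, (0 < N)%N /\ rho^-1 * (6 / N%:R) <=
    e.
  move=> e0; near=> N.
  have N0 : (0 < N)%N by near: N; exact: nbhs_infty_gt.
  split => //; rewrite ler_pdivrMl// ler_pdivrMr ?ltr0n// -ler_pdivrMl
    ?mulr_gt0//.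
  by near: N; exact: nbhs_infty_ger.
split; exists 0; apply/cvgrPdist_le => e e0; apply: filterS (small e e0) =>
  N [N0 Ne];
  by rewrite sub0r normrN; apply: le_trans Ne; have [? ?] := key N N0.
Unshelve. all: by end_near. Qed.

Lemma has_mean_re_trig (hd : (0 < d)%N) l (alpha : 'I_l -> {ffun 'I_d -> R}) c :
  has_mean (re_trig alpha c).
Proof.
apply: has_mean_sum => j; have [h1 h2] := has_mean_phase hd (alpha j).
by apply: has_meanD; exact: has_meanZ.
Qed.
End trig.

(** * Limits superior and densities *)

Section limits.
Context {R : realType}.
Implicit Types (v : nat -> \bar R).

Lemma limn_esup_lt_near v (a : \bar R) : (limn_esup v < a)%E ->
  \forall N \near \oo, (v N < a)%E.
Proof.
move=> /ereal_inf_lt[_ [V VF <-] lt]; apply: filterS VF => N VN.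
by apply: le_lt_trans lt; apply: ereal_sup_ubound; exists N.
Qed.

Lemma limn_esup_gt_freq v (a : \bar R) (V : set nat) : (a < limn_esup v)%E ->
  (\forall N \near \oo, V N) -> exists2 N, V N & (a < v N)%E.
Proof.
move=> lt VF; have : (a < ereal_sup (v @` V))%E.
  by apply: lt_le_trans lt _; apply: ereal_inf_lbound; exists V.
by move=> /ereal_sup_gt[_ [N VN <-]] aN; exists N.
Qed.

Lemma pos_between (x : \bar R) : (0 < x)%E -> exists2 r : R, 0 < r &
    (r%:E < x)%E.
Proof.
case: x => [r||]; rewrite ?lte_fin ?ltNyr// => r0.
  by exists (r / 2); rewrite ?divr_gt0// lte_fin ltr_pdivrMr// ltr_pMr// ltr1n.
by exists 1; rewrite ?ltr01 ?ltry.
Qed.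

Lemma limn_einf_gt0_near v : (0 < limn_einf v)%E ->
  exists2 r : R, 0 < r & \forall N \near \oo, (r%:E < v N)%E.
Proof.
move=> /pos_between[r r0 rv]; exists r => //.
have : (limn_esup (\- v) < - r%:E)%E by rewrite lteNr.
by move=> /limn_esup_lt_near; apply: filterS => N; rewrite lteN2.
Qed.
End limits.

Section density.
Context {R : realType} {d : nat}.
Hypothesis hd : (0 < d)%N.
Implicit Types A : set (vec d).

(** Almost periodicity in mean along the boxes based in B, for an indicator:
    B = {0} is the Besicovitch case and B = N^d the uniform one. *)
Definition ap_on (B : set (vec d)) A := forall e : R, 0 < e ->
  exists l (alpha : 'I_l -> {ffun 'I_d -> R}) (c : 'I_l -> R[i]),
    \forall N \near \oo, forall m, B m ->
      box_avg (trig_dist (\1_A : vec d -> R[i]) alpha c) m N <= e.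

Lemma besicovitch_ap_on A : besicovitch_ap (\1_A : vec d -> R[i]) ->
    ap_on [set 0] A.
Proof.
move=> H e e0; have [l [al [c [_ /limn_esup_lt_near near_e]]]] := H e e0.
exists l, al, c; apply: filterS near_e => N h m ->.
by rewrite ltW// -lte_fin.
Qed.

Lemma uniform_besicovitch_ap_on A :
  uniform_besicovitch_ap (\1_A : vec d -> R[i]) -> ap_on (@Npos d) A.
Proof.
move=> H e e0; have [l [al [c [_ /limn_esup_lt_near near_e]]]] := H e e0.
exists l, al, c; apply: filterS near_e => N h m Bm.
rewrite -lee_fin; apply: le_trans (ltW h); apply: ereal_sup_ubound.
by exists m.
Qed.

Lemma ap_on_approx B A (e : R) l (alpha : 'I_l -> {ffun 'I_d -> R}) (c : 'I_l ->
    R[i]) :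
  (\forall N \near \oo, forall m, B m ->
      box_avg (trig_dist (\1_A : vec d -> R[i]) alpha c) m N <= e) ->
  \forall N \near \oo, forall m, B m ->
      box_avg (fun x => `|\1_A x - re_trig alpha c x|) m N <= e.
Proof.
apply: filterS => N h m Bm; apply: le_trans (h m Bm).
by apply: le_box_avg => x; exact: re_trig_close.
Qed.

Lemma lower_banach_density_gt0 A : (0 < lower_banach_density R A)%E ->
  exists2 r : R, 0 < r & \forall L \near \oo, forall b, Npos b ->
    r <= box_freq R A b L.
Proof.
move=> /limn_einf_gt0_near[r r0 H]; exists r => //; apply: filterS H =>
  N h b Bb.
rewrite -lee_fin; apply: le_trans (ltW h) _; apply: ereal_inf_lbound.
by exists b.
Qed.

(** The averages of a trigonometric polynomial converge, so the frequencies of A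
    oscillate by no more than twice the approximation error: as they are
    infinitely often above r, they cannot drop below r / 4 infinitely often. *)
Lemma upper_density_gt0 A : ap_on [set 0] A -> (0 < upper_density R A)%E ->
  exists2 r : R, 0 < r & \forall L \near \oo, forall b, [set 0] b ->
    r <= box_freq R A b L.
Proof.
move=> apA /pos_between[r r0 rd]; have r4 : 0 < r / 4 by rewrite divr_gt0.
have [l [al [c Hlc]]] := apA _ r4.
have := ap_on_approx Hlc; move=> Hap.
have [mn Hmn] := has_mean_re_trig hd al c.
have Hm : \forall N \near \oo, `|mn - box_avg (re_trig al c) 0 N| <= r / 8.
  by move/cvgrPdist_le: Hmn; apply; rewrite divr_gt0.
have close : \forall N \near \oo, `|box_freq R A 0 N - mn| <= r / 4 + r / 8.
  apply: filterS2 Hap Hm => N h1 h2; rewrite box_freqE.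
  have h3 : `|box_avg (\1_A) 0 N - box_avg (re_trig al c) 0 N| <= r / 4.
    apply: le_trans (h1 0 erefl).
    rewrite -box_avgB !box_avgE normrM normfV normrX normr_nat ler_wpM2r
      ?invr_ge0//.
    exact: ler_norm_sum.
  move: h2 h3; rewrite !ler_norml => /andP[? ?] /andP[? ?]; apply/andP; split;
    lra.
have [N cN fN] := limn_esup_gt_freq rd close.
move: fN; rewrite lte_fin => fN.
exists (r / 4) => //; apply: filterS close => L cL b ->.
move: cL cN; rewrite !ler_norml => /andP[? ?] /andP[? ?]; lra.
Qed.
End density.

(** * The two notions of equidistribution, and the theorem *)

Section ud_defs.
Context {R : realType} {K : topologicalZmodType}.
Variable mu : probability [the measurableType _ of borel K] R.
Context {d : nat}.

Lemma uniformly_distributedP (v : vec d -> K) :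
  uniformly_distributed mu v <-> ud_on mu [set 0] v.
Proof.
split=> H U oU bU.
  move=> e e0; have := H U oU bU; move=> /cvgrPdist_le /(_ _ e0).
  by apply: filterS => N h m ->; rewrite distrC.
apply/cvgrPdist_le => e e0; have := H U oU bU e e0.
by apply: filterS => N /(_ 0 erefl); rewrite distrC.
Qed.

Lemma well_distributedP (v : vec d -> K) :
  well_distributed mu v <-> ud_on mu (@Npos d) v.
Proof.
split=> H U oU bU.
  move=> e e0.
  pose F (m : vec d) : R := fine (mu (U : set (borel K))).
  have nF : nbhs (F : {uniform` @Npos d -> R})
      [set g : vec d -> R | forall y, Npos y -> ball (F y) e (g y)].
    apply/uniform_nbhs; exists [set xy | ball xy.1 e xy.2]; split => //.
    exact: entourage_ball (PosNum e0).
  have : \forall N \near \oo, forall y, Npos y ->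
      ball (F y) e (box_freq R (v @^-1` U) y N).
    exact: H nF.
  apply: filterS => N h m Bm.
  by have := h m Bm; rewrite /ball/= distrC => /ltW.
move=> P /uniform_nbhs[E [+ sub]]; rewrite -entourage_ballE => -[e /= e0 eE].
have e20 : 0 < e / 2 by rewrite divr_gt0.
have := H U oU bU _ e20; apply: filterS => N h; apply: sub => m Bm.
apply: eE; rewrite /= /ball /= distrC; apply: le_lt_trans (h m Bm) _.
by rewrite ltr_pdivrMr// ltr_pMr// ltr1n.
Qed.
End ud_defs.

Section transfer.
Context {R : realType} {K : topologicalZmodType}.
Hypothesis cK : compact [set: K].
Hypothesis hK : hausdorff_space K.
Variable mu : probability [the measurableType _ of borel K] R.
Hypothesis hmu : is_haar mu.
Context {d : nat}.
Hypothesis hd : (0 < d)%N.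
Variable B : set (vec d).
Variable u : vec d -> K.
Hypothesis Hu : forall h, Npos h -> ud_on mu B (fun m => u (m + h) - u m).

Lemma ap_null_weight (A : set (vec d)) : ap_on (R := R) B A ->
  forall f : K -> R, continuous f -> \int[mu]_x f x = 0 ->
    null_weight B f u (\1_A).
Proof.
move=> apA f cf f0; apply: null_weight_approx => // e e0.
have [l [al [c /ap_on_approx Hap]]] := apA e e0.
exists (re_trig al c) => //; apply: null_weight_sum => j.
have [h1 h2] := null_weight_trig cK hmu hd cf f0 Hu (phaseD (al j)).
by apply: null_weightD; exact: null_weightZ.
Qed.

Lemma ud_on_besicovitch (n : vec d -> vec d) (r : R) : {homo n : a / Npos a} ->
    increasing_vec n ->
  (forall m, B m -> B (nu n m)) -> ap_on (R := R) B (n @` @Npos d) -> 0 < r ->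
  (\forall L \near \oo, forall b, B b -> r <= box_freq R (n @` @Npos d) b L) ->
  ud_on mu B (fun k => u (n k)).
Proof.
move=> nP nI Bnu apA r0 Hr.
by apply: (ud_on_subsequence cK hK hmu hd nP nI Bnu r0 Hr);
  exact: ap_null_weight.
Qed.
End transfer.

Theorem theorem4p6 (R : realType) (d : nat) (hd : (0 < d)%N)
    (K : topologicalZmodType) (cK : compact [set: K]) (hK : hausdorff_space K)
    (mu : probability (borel K) R) (hmu : is_haar mu) (u : vec d -> K) :
  ((forall h : vec d, Npos h ->
      uniformly_distributed mu (fun m : vec d => u (m + h) - u m)) ->
    forall n : vec d -> vec d, besicovitch_sequence R n ->
      uniformly_distributed mu (fun k : vec d => u (n k))) /\
  ((forall h : vec d, Npos h ->
      well_distributed mu (fun m : vec d => u (m + h) - u m)) ->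
    forall n : vec d -> vec d, uniform_besicovitch_sequence R n ->
      well_distributed mu (fun k : vec d => u (n k))).
Proof.
split=> Hu n [nP nI ap dens].
  have {}ap := besicovitch_ap_on ap.
  have [r r0 Hr] := upper_density_gt0 hd ap dens.
  apply/(uniformly_distributedP mu);
    apply: (ud_on_besicovitch cK hK hmu hd _ nP nI _ ap r0 Hr).
    by move=> h Nh; apply/(uniformly_distributedP mu); exact: Hu.
  by move=> m ->; apply/ffunP => j; rewrite !ffunE.
have {}ap := uniform_besicovitch_ap_on ap.
have [r r0 Hr] := lower_banach_density_gt0 dens.
apply/(well_distributedP mu);
  apply: (ud_on_besicovitch cK hK hmu hd _ nP nI _ ap r0 Hr).
  by move=> h Nh; apply/(well_distributedP mu); exact: Hu.
by move=> m Nm j; rewrite ffunE /nu1 gtn_eqF ?Nm//; apply: nP;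
  exact: Npos_diagv.
Qed.
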